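(* For $a\in[0.4,0.5]$ and $b=0.4$, let $P$ be the convex quadrilateral with vertices $A=(0,1)$, $B=(a,1)$, $C=(1,b)$, $D=(0,0)$, let $\lambda=1-b=0.6$, and let $T$ be the outer billiards map with contraction $\lambda$ outside $P$. Then the entire domain is asymptotic to $K_{(a,b)}$, i.e. every $x\in X$ is asymptotic to $K_{(a,b)}$. In particular, there exist values of $(a,b)$ for which the entire domain is asymptotic to a single Cantor set.
   Context: Outer billiards with contraction: for a convex polygon $P$ and $0<\lambda<1$, given a generic $x\in\mathbb R^2\setminus P$ there is a unique vertex $v$ of $P$ such that $P$ lies on the left of the ray from $x$ through $v$; set $Tx=(1+\lambda)v-\lambda x$. If $A_1,\dots,A_n$ are the vertices of $P$ in clockwise order, let $S$ be the union of the rays $\overrightarrow{A_1A_2},\dots,\overrightarrow{A_nA_1}$ (starting at the first point and containing the side); $T$ is defined on $\mathbb R^2\setminus(P\cup S)$. Let $X=\mathbb R^2\setminus\big(P\cup\bigcup_{i\ge0}T^{-i}S\big)$, the set of points whose whole forward orbit is defined; this is the domain meant in the claim. A point $x\in X$ is asymptotic to a closed set $K$ if its $\omega$-limit set under $T$ equals $K$ (all orbits are bounded). A Cantor set is a set homeomorphic to the middle-thirds set. Rectangles: let $\mu=1/\lambda$, $l=\mu+(1-a)\mu^2$. For $\epsilon>0$ small, $R_1=[-l+\epsilon,0]\times[1,1+\epsilon^2]$ and $R_2=[-l+\epsilon,0]\times[1-\epsilon^2,1]$. $K_{(a,b)}$ denotes the unique attractor for points in $X\cap(R_1\cup R_2)$: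 all points of $X\cap(R_1\cup R_2)$ (for $\epsilon$ sufficiently small) have the same $\omega$-limit set under $T$, which is independent of $\epsilon$ and is denoted $K_{(a,b)}$. *)

(* Defs.v *)
(* MathComp-Analysis, over an arbitrary R : realType; the plane is R * R. *)
From HB Require Import structures.
From mathcomp Require Import all_boot all_order all_algebra.
From mathcomp Require Import all_classical all_reals all_analysis.

Set Implicit Arguments.
Unset Strict Implicit.
Unset Printing Implicit Defensive.

Import Order.TTheory GRing.Theory Num.Theory.
Import numFieldNormedType.Exports.

Local Open Scope classical_set_scope.
Local Open Scope ring_scope.

(* A polygon is given by its vertices A_0, ..., A_(n-1) in clockwise order;
   [ordS i] is the cyclic successor of the index i. *)
Definition polygon (R : realType) (n : nat) (A : 'I_n -> R * R) : set (R * R) :=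
  smallest (@convex_set R (R * R)%type) (range A).

(* The closed half-plane on the left of the ray from x through v. *)
Definition left_of (R : realType) (x v : R * R) : set (R * R) :=
  [set p | 0 <= (v.1 - x.1) * (p.2 - x.2) - (v.2 - x.2) * (p.1 - x.1)].

Definition ray (R : realType) (u v : R * R) : set (R * R) :=
  [set p | exists2 t : R, 0 <= t & p = u + t *: (v - u)].

Definition side_rays (R : realType) (n : nat) (A : 'I_n -> R * R)
    : set (R * R) :=
  \bigcup_i ray (A i) (A (ordS i)).

Definition tangent_vertex (R : realType) (n : nat) (A : 'I_n -> R * R)
    (x : R * R) : R * R :=
  get [set v | range A v /\ polygon A `<=` left_of x v].

(* Only meaningful off [polygon A] and [side_rays A], where the tangent vertex
   is unique; the total extension plays no role on [orbit_domain]. *)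
Definition outer_billiard (R : realType) (n : nat) (A : 'I_n -> R * R)
    (lambda : R) (x : R * R) : R * R :=
  (1 + lambda) *: tangent_vertex A x - lambda *: x.

Definition orbit_domain (R : realType) (n : nat) (A : 'I_n -> R * R)
    (lambda : R) : set (R * R) :=
  ~` (polygon A `|`
      \bigcup_i (iter i (outer_billiard A lambda) @^-1` side_rays A)).

Definition omega_limit (T : topologicalType) (f : T -> T) (x : T) : set T :=
  cluster ((fun k : nat => iter k f x) @ \oo).

(* No closedness condition on K is needed: cluster sets are closed. *)
Definition asymptotic_to (T : topologicalType) (f : T -> T) (x : T)
    (K : set T) : Prop :=
  omega_limit f x = K.

Definition homeomorphic_sets (T U : topologicalType) (A : set T) (B : set U)
    : Prop :=
  exists (f : T -> U) (g : U -> T),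
    [/\ set_fun A B f, set_fun B A g,
        {in A, cancel f g} /\ {in B, cancel g f},
        {within A, continuous f} & {within B, continuous g}].

Definition middle_thirds (R : realType) : set R :=
  \bigcap_n iter n
    (fun C : set R => (fun t => t / 3) @` C `|` (fun t => (t + 2) / 3) @` C)
    `[0, 1]%classic.

Definition is_cantor_set (R : realType) (T : topologicalType) (K : set T)
    : Prop :=
  homeomorphic_sets (@middle_thirds R) K.

Definition quad (R : realType) (a b : R) : 'I_4 -> R * R :=
  tnth [tuple (0, 1); (a, 1); (1, b); (0, 0)].

(* For the quadrilateral family the contraction rate is always 1 - b. *)
Definition quad_map (R : realType) (a b : R) : R * R -> R * R :=
  outer_billiard (quad a b) (1 - b).

Definition quad_domain (R : realType) (a b : R) : set (R * R) :=
  orbit_domain (quad a b) (1 - b).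

Definition upper_rect (R : realType) (a b eps : R) : set (R * R) :=
  let mu := (1 - b)^-1 in
  let l := mu + (1 - a) * mu ^+ 2 in
  `[- l + eps, 0]%classic `*` `[1, 1 + eps ^+ 2]%classic.

Definition lower_rect (R : realType) (a b eps : R) : set (R * R) :=
  let mu := (1 - b)^-1 in
  let l := mu + (1 - a) * mu ^+ 2 in
  `[- l + eps, 0]%classic `*` `[1 - eps ^+ 2, 1]%classic.

(* The nonemptiness clause makes such a K unique. *)
Definition is_rect_attractor (R : realType) (a b : R) (K : set (R * R))
    : Prop :=
  exists2 eps0 : R, 0 < eps0 & forall eps : R, 0 < eps < eps0 ->
    let D := quad_domain a b `&` (upper_rect a b eps `|` lower_rect a b eps) in
    D !=set0 /\ forall x, D x -> asymptotic_to (quad_map a b) x K.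

Definition attractor (R : realType) (a b : R) : set (R * R) :=
  get [set K | is_rect_attractor a b K].

(* Main.v *)
Require Import Defs.
From HB Require Import structures.
From mathcomp Require Import all_boot all_order all_algebra.
From mathcomp Require Import all_classical all_reals all_analysis.
From mathcomp Require Import ring lra.

Set Implicit Arguments.
Unset Strict Implicit.
Unset Printing Implicit Defensive.

Import Order.TTheory GRing.Theory Num.Theory.
Import numFieldNormedType.Exports.

Local Open Scope classical_set_scope.
Local Open Scope ring_scope.

(** Write lam = 3/5 and b = 2/5.  On each of the four regions cut out by the side
    rays the map is a contracted reflection, of ratio -lam, in one vertex.

    Global part.  The coordinates of an orbit are driven into a bounded box.
    There, elementary inequalities leave few transitions between the vertices
    used: (0, 0) is followed by (1, b), which is followed by (a, 1) or (0, 1);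
    then (a, 1) is followed by (0, 1) or (0, 0), and (0, 1) by (0, 0).  So every
    orbit comes to the left of P, where (0, 0) is used.  Since lam = 1 - b, the
    reflections in (0, 0) and then in (1, b) map the line y = 1 into itself, and
    the next one is in a vertex of that line.  So the height y - 1 tends to 0
    geometrically while changing sign, and only its sign (it never vanishes,
    because the line right of (0, 1) is a forbidden ray) decides between the
    vertices (0, 1) and (a, 1).

    One-dimensional part.  Follow the returns to the left of P with y < 1.
    The abscissa then evolves by a two-branch map with a single break c:
    x goes to lam^4 (x - c) if x < c and to -24/25 + lam^6 (x - c) if c < x,
    and the orbits that hit c are those that hit a forbidden ray.  Such a map
    can be renormalised: as long as one branch sends a part of its side to the
    same side, the first return to a smaller interval around c is again of this
    form, with new return times, and the length shrinks by a factor lam.  Two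
    points in the same branch have orbits that differ by an exact multiple
    (-lam)^j of their difference until the return.  If the procedure stops, the
    two branches exchange the sides of c (or c is outside the interval from the
    start), and the tails of any two orbits stay coupled forever; if it does not, both branches of arbitrarily small intervals are
    visited infinitely often by all orbits.  Either way any orbit follows any
    other one up to any eps (regular_shadows), so all omega-limit sets
    coincide (domain_omega_limit), and the common one is the attractor.  For
    this the domain must meet the thin rectangles: the points to avoid are the
    preimages of c, which are countable.

    Cantor part.  If the renormalisation never stops, the omega-limit set has
    no isolated point, because each small piece of it contains the images of
    both ends of a branch; and its two coordinate projections contain no
    interval, because a whole cycle of images of an interval of length d has
    total length at most a constant times d, the sum of a geometric series.
    A nonempty compact set with these two properties is a Cantor set
    (cantor_criterion).  A break for which the two kinds of renormalisation
    alternate forever exists: the ends of the renormalised intervals are affine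
    functions of c, and the sets of c for which the first k steps are possible
    are nested intervals whose ends both move at each step (exists_break). *)

(** * Coupled orbits and renormalisation of a two-branch contraction *)

Section Dynamics.
Variables (R : realType) (V : normedModType R) (T : V -> V) (lam : R).
Hypothesis lam01 : 0 < lam < 1.

Let lam_gt0 : 0 < lam. Proof. by case/andP: lam01. Qed.
Let lam_lt1 : lam < 1. Proof. by case/andP: lam01. Qed.

(** The time k is only required to exist beyond every M, because this is all that
    carrying a cluster point from one orbit to the other needs. *)
Definition shadows (eps : R) (z w : V) : Prop :=
  exists N, forall n, (N <= n)%N -> forall M, exists2 k, (M <= k)%N &
    `|iter n T z - iter k T w| <= eps.

Lemma omega_limitP (z x : V) : omega_limit T z x <->
  forall eps, 0 < eps -> forall M, exists2 k, (M <= k)%N &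
    `|x - iter k T z| < eps.
Proof.
split=> [clx eps e0 M|H A B [M _ AM] /nbhs_ballP[e /= e0 Be]].
  have tailM : ((fun k => iter k T z) @ \oo)
      [set iter k T z | k in [set k | (M <= k)%N]].
    by exists M => // k /= Mk; exists k.
  have [y [[k /= Mk <-]]] := clx _ _ tailM (nbhsx_ballx x _ e0).
  by rewrite -ball_normE; exists k.
have [k Mk xk] := H _ e0 M; exists (iter k T z); split; first exact: AM.
by apply: Be; rewrite -ball_normE.
Qed.

Lemma omega_limit_sub_closed (z : V) (F : set V) N : closed F ->
  (forall k, (N <= k)%N -> F (iter k T z)) -> omega_limit T z `<=` F.
Proof.
move=> cF FN x; rewrite /omega_limit clusterE => H.
rewrite (closure_id F).1//; apply: H; exists N => // k /=; exact: FN.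
Qed.

Lemma omega_limit_closed (z : V) : closed (omega_limit T z).
Proof.
by rewrite /omega_limit clusterE; apply: closed_bigI => A _; exact: closed_closure.
Qed.

Lemma shadows_omega_sub (z w : V) :
  (forall eps, 0 < eps -> shadows eps z w) ->
  omega_limit T z `<=` omega_limit T w.
Proof.
move=> zw x /omega_limitP clx; apply/omega_limitP => eps e0 M.
have e20 : 0 < eps / 2 by rewrite divr_gt0.
have [N HN] := zw _ e20; have [n Nn xn] := clx _ e20 N.
have [k Mk nk] := HN n Nn M; exists k => //.
by apply: le_lt_trans (ler_distD (iter n T z) _ _) _; lra.
Qed.

Lemma shadows_iter (eps : R) (i j : nat) (z w : V) :
  shadows eps (iter i T z) (iter j T w) -> shadows eps z w.
Proof.
move=> [N HN]; exists (N + i)%N => n Nn M.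
have [|k Mk] := HN (n - i)%N _ M; first by rewrite leq_subRL ?(leq_trans _ Nn) ?leq_addl// addnC.
rewrite -!iterD subnK; last by apply: leq_trans Nn; exact: leq_addl.
by move=> nk; exists (k + j)%N => //; exact: leq_trans Mk (leq_addr _ _).
Qed.

(** Two orbits are coupled as long as they use the same affine branches, all of
    which have linear part -lam. *)
Definition coupled (n : nat) (z w : V) : Prop :=
  forall j, (j <= n)%N ->
    iter j T z - iter j T w = (- lam) ^+ j *: (z - w).

Lemma coupled_cat m n z w : coupled m z w ->
  coupled n (iter m T z) (iter m T w) -> coupled (n + m) z w.
Proof.
move=> zw1 zw2 j jmn; case: (leqP j m) => jm; first exact: zw1.
rewrite -(subnK (ltnW jm)) !iterD zw2; last by rewrite leq_subLR addnC.
by rewrite zw1// exprD scalerA.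
Qed.

Lemma coupled_le n z w j : coupled n z w -> (j <= n)%N ->
  `|iter j T z - iter j T w| <= lam ^+ j * `|z - w|.
Proof.
by move=> zw jn; rewrite zw// normrZ normrX normrN gtr0_norm//.
Qed.

Lemma coupled_le1 n z w j : coupled n z w -> (j <= n)%N ->
  `|iter j T z - iter j T w| <= `|z - w|.
Proof.
move=> zw jn; apply: le_trans (coupled_le zw jn) _.
by apply: ler_piMl => //; apply: exprn_ile1; exact: ltW.
Qed.

(** The degenerate alternative to infinite renormalisation: up to a shift of
    time all orbits have the same itinerary, hence approach each other. *)
Definition phase_locked (G : set V) : Prop :=
  exists W : set V, [/\ W `<=` G,
    forall z, G z -> forall M, exists2 t, (M <= t)%N & W (iter t T z) &
    forall w w', W w -> W w' -> forall n, coupled n w w'].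

Lemma lam_small (D eps : R) : 0 < eps -> exists J, forall j, (J <= j)%N ->
  lam ^+ j * D <= eps.
Proof.
move=> e0.
have /cvgrPdist_le/(_ _ e0) [J _ HJ] : lam ^+ j * D @[j --> \oo] --> (0 : R).
  rewrite -(mul0r D); apply: cvgMl; apply: cvg_expr.
  by rewrite gtr0_norm.
exists J => j Jj; have := HJ j Jj; rewrite sub0r normrN.
by apply: le_trans; exact: ler_norm.
Qed.

Lemma phase_locked_shadows (G : set V) (D eps : R) (z w : V) : phase_locked G ->
  (forall w w', G w -> G w' -> `|w - w'| <= D) -> 0 < eps ->
  G z -> G w -> shadows eps z w.
Proof.
move=> [W [WG visit WW]] GD e0 Gz Gw.
have [J HJ] := lam_small D e0.
have [s _ Ws] := visit _ Gz 0%N.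
exists (J + s)%N => n Jn M; have [t Mt Wt] := visit _ Gw M.
exists (n - s + t)%N; first exact: leq_trans Mt (leq_addl _ _).
have {1}-> : n = (n - s + s)%N by rewrite subnK// (leq_trans _ Jn)// leq_addl.
rewrite !iterD; apply: le_trans (coupled_le (WW _ _ Ws Wt _) (leqnn _)) _.
have : lam ^+ (n - s) * D <= eps by apply: HJ; rewrite leq_subRL ?(leq_trans _ Jn) ?leq_addl// addnC.
by apply: le_trans; apply: ler_wpM2l; [apply: exprn_ge0; exact: ltW|apply: GD; exact: WG].
Qed.

(** The two branches are normalised by their one-sided limits at the break: q
    from the left and p from the right.  With this normalisation the class is
    closed under inducing, and the slopes are the powers of lam given by the
    return times.  The orbits of G never meet the break itself. *)
Record renorm (h : V -> R) (c : R) (G : set V) (p q : R) (m n : nat) : Prop :=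
  Renorm {
  renorm_avoid : forall z, G z -> h z != c;
  renorm_m : (0 < m)%N;
  renorm_n : (0 < n)%N;
  renorm_pc : p < c;
  renorm_cq : c < q;
  renorm_left_return : forall z, G z -> p < h z < c ->
    G (iter m T z) /\ h (iter m T z) = q + lam ^+ m * (h z - c);
  renorm_right_return : forall z, G z -> c < h z < q ->
    G (iter n T z) /\ h (iter n T z) = p + lam ^+ n * (h z - c);
  renorm_left_coupled : forall z w, G z -> G w ->
    p < h z < c -> p < h w < c -> coupled m z w;
  renorm_right_coupled : forall z w, G z -> G w ->
    c < h z < q -> c < h w < q -> coupled n z w;
  renorm_enter : forall z, G z ->
    exists j, G (iter j T z) /\ p < h (iter j T z) < q }.

(** Reflecting the coordinate exchanges the two branches, so that facts about
    one side of the break give those about the other side. *)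
Lemma renorm_opp h c G p q m n : renorm h c G p q m n ->
  renorm (\- h) (- c) G (- q) (- p) n m.
Proof.
case=> av m0 n0 pc cq lr rr lc rc en; split => //.
- by move=> z /av; rewrite eqr_opp.
- lra.
- lra.
- move=> z Gz hz; have [|? hn] := rr _ Gz; first by move: hz => /=; lra.
  by split=> //=; rewrite hn; ring.
- move=> z Gz hz; have [|? hm] := lr _ Gz; first by move: hz => /=; lra.
  by split=> //=; rewrite hm; ring.
- by move=> z w Gz Gw /= hz hw; apply: rc => //; lra.
- by move=> z w Gz Gw /= hz hw; apply: lc => //; lra.
- by move=> z /en[j [Gj hj]]; exists j; split=> //=; lra.
Qed.

Lemma lamX_gt0 k : 0 < lam ^+ k. Proof. exact: exprn_gt0. Qed.
Lemma lamX_lt1 k : (0 < k)%N -> lam ^+ k < 1.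
Proof. by move=> k0; rewrite exprn_ilt1 -?lt0n// ltW. Qed.

(** If the right branch overshoots the break, its image is an interval (p, q')
    that contains c.  The left branch then maps (p, c) into (c, q), so the first
    return to (p, q') is the right branch on the right of c and, on the left of
    c, the left branch followed by the right one. *)
Lemma renorm_induce_right h c G p q m n : renorm h c G p q m n ->
  c < p + lam ^+ n * (q - c) ->
  renorm h c G p (p + lam ^+ n * (q - c)) (n + m) n.
Proof.
case=> av m0 n0 pc cq lr rr lc rc en cq'.
have u0 := lamX_gt0 n; have u1 := lamX_lt1 n0.
have v0 := lamX_gt0 m; have v1 := lamX_lt1 m0.
set u := lam ^+ n in rr cq' u0 u1 *; set v := lam ^+ m in lr v0 v1.
have q'q : p + u * (q - c) < q by nra.
have left_to_right z : p < h z < c -> c < q + v * (h z - c) < q.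
  move=> /andP[h1 h2]; apply/andP; split; last by nra.
  have : v * (c - h z) < c - h z by nra.
  have : c - h z < u * (q - c) by lra.
  nra.
split=> //.
- by rewrite addn_gt0 n0.
- move=> z Gz hz; have [Gm hm] := lr _ Gz hz.
  have [|Gn hn] := rr _ Gm; first by rewrite hm; exact: left_to_right.
  rewrite iterD; split=> //; rewrite hn hm exprD -/u -/v; ring.
- by move=> z Gz hz; apply: rr => //; lra.
- move=> z w Gz Gw hz hw; apply: coupled_cat; first exact: lc.
  have [Gm hm] := lr _ Gz hz; have [Gm' hm'] := lr _ Gw hw.
  by apply: rc => //; rewrite ?hm ?hm'; exact: left_to_right.
- by move=> z w Gz Gw hz hw; apply: rc => //; lra.
- move=> z Gz; have [j [Gj hj]] := en _ Gz.
  have right_enters w : G w -> c < h w < q ->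
      G (iter n T w) /\ p < h (iter n T w) < p + u * (q - c).
    move=> Gw hw; have [Gn hn] := rr _ Gw hw; split=> //; rewrite hn.
    by case/andP: hw => ? ?; apply/andP; split; nra.
  have := av _ Gj; rewrite neq_lt => /orP[hc|hc].
    have hl : p < h (iter j T z) < c by lra.
    have [Gm hm] := lr _ Gj hl.
    exists (n + (m + j))%N; rewrite !iterD; apply: right_enters => //.
    by rewrite hm; exact: left_to_right.
  by exists (n + j)%N; rewrite iterD; apply: right_enters => //; lra.
Qed.

Lemma renorm_induce_left h c G p q m n : renorm h c G p q m n ->
  q + lam ^+ m * (p - c) < c ->
  renorm h c G (q + lam ^+ m * (p - c)) q m (m + n).
Proof.
move=> /renorm_opp rn cq.
have /(renorm_induce_right rn)/renorm_opp : - c < - q + lam ^+ m * (- p - - c).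
  by lra.
have -> : \- (\- h) = h by apply/funext => z /=; rewrite opprK.
have -> : - (- q + lam ^+ m * (- p - - c)) = q + lam ^+ m * (p - c) by ring.
by rewrite !opprK.
Qed.

(** If no branch overshoots the break, each side is mapped into the other one:
    the itinerary alternates and is the same for all orbits. *)
Lemma renorm_phase_locked h c G p q m n : renorm h c G p q m n ->
  p + lam ^+ n * (q - c) <= c -> c <= q + lam ^+ m * (p - c) -> phase_locked G.
Proof.
case=> av m0 n0 pc cq lr rr lc rc en cq' cp'.
have u0 := lamX_gt0 n; have v0 := lamX_gt0 m.
set u := lam ^+ n in rr cq' u0 *; set v := lam ^+ m in lr v0 cp'.
pose W := [set z | G z /\ c < h z < q].
have RL z : W z -> G (iter n T z) /\ p < h (iter n T z) < c.
  move=> [Gz hz]; have [Gn hn] := rr _ Gz hz; split=> //; rewrite hn.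
  by case/andP: hz => ? ?; apply/andP; split; nra.
have LR z : G z -> p < h z < c -> W (iter m T z).
  move=> Gz hz; have [Gn hn] := lr _ Gz hz; split=> //; rewrite hn.
  by case/andP: hz => ? ?; apply/andP; split; nra.
have WW z : W z -> W (iter (m + n) T z).
  by move=> /RL[? ?]; rewrite iterD; apply: LR.
have Wk z k : W z -> W (iter (k * (m + n)) T z).
  by move=> Wz; elim: k => // k IH; rewrite mulSn iterD; exact: WW.
exists W; split.
- by move=> z [].
- move=> z Gz M; have [j [Gj hj]] := en _ Gz.
  have [i Wi] : exists i, W (iter i T z).
    have := av _ Gj; rewrite neq_lt => /orP[hc|hc].
      by exists (m + j)%N; rewrite iterD; apply: LR => //; lra.
    by exists j; split=> //; lra.
  exists (M * (m + n) + i)%N; first by rewrite -[leqLHS]muln1 (leq_trans _ (leq_addr _ _))// leq_mul2l addn_gt0 m0 orbT.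
  by rewrite iterD; exact: Wk.
- move=> z w Wz Ww k.
  have CC z1 w1 : W z1 -> W w1 -> coupled (m + n) z1 w1.
    move=> Wz1 Ww1; apply: coupled_cat.
      by case: Wz1 => ? ?; case: Ww1 => ? ?; exact: rc.
    by have [? ?] := RL _ Wz1; have [? ?] := RL _ Ww1; exact: lc.
  have : coupled (k * (m + n)) z w.
    elim: k => [|k IH]; last by rewrite mulSn; apply: coupled_cat => //; apply: CC; exact: Wk.
    by move=> j; rewrite mul0n leqn0 => /eqP->; rewrite expr0 scale1r.
  by move=> H j jk; apply: H; apply: leq_trans jk _; rewrite -[leqLHS]muln1 leq_mul2l addn_gt0 m0 orbT.
Qed.

(** An induced interval is the image of one side of the break under a branch of
    ratio at most lam. *)
Lemma renorm_shrink h c G p q m n k : renorm h c G p q m n ->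
  phase_locked G \/ exists p' q' m' n',
    renorm h c G p' q' m' n' /\ q' - p' <= lam ^+ k * (q - p).
Proof.
move=> rn0; elim: k => [|k [|[p' [q' [m' [n' [rn le]]]]]]]; [|by left|].
  by right; exists p, q, m, n; rewrite expr0 mul1r.
have lle j : (0 < j)%N -> lam ^+ j <= lam.
  by case: j => // j _; rewrite exprS; apply: ler_piMr; rewrite ?exprn_ile1 ?ltW.
have pc := renorm_pc rn; have cq := renorm_cq rn.
have lm := lle _ (renorm_m rn); have ln := lle _ (renorm_n rn).
have l0 := lam_gt0; have um := lamX_gt0 m'; have un := lamX_gt0 n'.
have le' : lam * (q' - p') <= lam ^+ k.+1 * (q - p).
  by rewrite exprS -mulrA; apply: ler_wpM2l => //; lra.
case: (ltP c (p' + lam ^+ n' * (q' - c))) => H1.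
  right; exists p', (p' + lam ^+ n' * (q' - c)), (n' + m')%N, n'; split.
    exact: renorm_induce_right.
  by apply: le_trans le'; nra.
case: (ltP (q' + lam ^+ m' * (p' - c)) c) => H2.
  right; exists (q' + lam ^+ m' * (p' - c)), q', m', (m' + n')%N; split.
    exact: renorm_induce_left.
  by apply: le_trans le'; nra.
by left; exact: (renorm_phase_locked rn).
Qed.

Lemma renorm_return_late h c G p q m n z M : renorm h c G p q m n -> G z ->
  exists2 t, (M <= t)%N & G (iter t T z) /\ p < h (iter t T z) < q.
Proof.
case=> av m0 n0 pc cq lr rr lc rc en Gz.
have u0 := lamX_gt0 n; have u1 := lamX_lt1 n0.
have v0 := lamX_gt0 m; have v1 := lamX_lt1 m0.
elim: M => [|M [t Mt [Gt ht]]]; first by have [j Hj] := en _ Gz; exists j.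
have := av _ Gt; rewrite neq_lt => /orP[hc|hc].
  exists (m + t)%N; first by rewrite -add1n leq_add.
  rewrite iterD; have [|? ->] := lr _ Gt; first by lra.
  by split=> //; case/andP: ht => ? ?; apply/andP; split; nra.
exists (n + t)%N; first by rewrite -add1n leq_add.
rewrite iterD; have [|? ->] := rr _ Gt; first by lra.
by split=> //; case/andP: ht => ? ?; apply/andP; split; nra.
Qed.

(** No orbit stays on the right of c forever: the right branch would then move
    it to the left by at least c - p at each return, since it has limit p at c
    and slope less than 1. *)
Lemma renorm_left_late h c G p q m n z M : renorm h c G p q m n -> G z ->
  exists2 t, (M <= t)%N & G (iter t T z) /\ p < h (iter t T z) < c.
Proof.
move=> rn Gz; apply: contrapT => noleft.
have [t Mt [Gt ht]] := renorm_return_late M rn Gz.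
have right t' : (M <= t')%N -> G (iter t' T z) -> p < h (iter t' T z) < q ->
    c < h (iter t' T z) < q.
  move=> Mt' Gt' ht'; have := renorm_avoid rn Gt'; rewrite neq_lt.
  move=> /orP[hc|hc]; last by lra.
  by exfalso; apply: noleft; exists t' => //; split=> //; lra.
have pc := renorm_pc rn.
have u0 := lamX_gt0 n; have u1 := lamX_lt1 (renorm_n rn).
have stay k : exists2 t', (M <= t')%N &
    [/\ G (iter t' T z), c < h (iter t' T z) < q &
        h (iter t' T z) - c <= q - c - k%:R * (c - p)].
  elim: k => [|k [t' Mt' [Gt' ht' le]]].
    by exists t => //; split=> //; [exact: right|lra].
  have [Gn hn] := renorm_right_return rn Gt' ht'.
  exists (n + t')%N; first exact: leq_trans Mt' (leq_addl _ _).
  have le' : h (iter (n + t') T z) - c <= q - c - k.+1%:R * (c - p).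
    rewrite iterD hn -natr1; case/andP: ht' => ? ?; nra.
  rewrite iterD in le' *; split=> //.
  rewrite -iterD; apply: right; [exact: leq_trans Mt' (leq_addl _ _)|by rewrite iterD|].
  by rewrite iterD hn; case/andP: ht' => ? ?; apply/andP; split; nra.
have [t' _ [_ /andP[ct' _]]] := stay (Num.truncn ((q - c) / (c - p))).+1.
have : (q - c) / (c - p) < (Num.truncn ((q - c) / (c - p))).+1%:R.
  by rewrite truncnS_gt.
rewrite ltr_pdivrMr; last by lra.
lra.
Qed.

Lemma renorm_right_late h c G p q m n z M : renorm h c G p q m n -> G z ->
  exists2 t, (M <= t)%N & G (iter t T z) /\ c < h (iter t T z) < q.
Proof.
move=> /renorm_opp rn Gz; have [t Mt [Gt /= ht]] := renorm_left_late M rn Gz.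
by exists t => //; split=> //; lra.
Qed.

(** From its first visit to (p, q) on, an orbit is a concatenation of excursions
    of one of the two kinds. *)
Lemma renorm_parse h c G p q m n z : renorm h c G p q m n -> G z ->
  exists N, forall k, (N <= k)%N -> exists s j, [/\ k = (j + s)%N,
    G (iter s T z) &
    (p < h (iter s T z) < c /\ (j < m)%N) \/
    (c < h (iter s T z) < q /\ (j < n)%N)].
Proof.
move=> rn Gz; have [N [GN hN]] := renorm_enter rn Gz.
case: rn => av m0 n0 pc cq lr rr lc rc en.
have u0 := lamX_gt0 n; have u1 := lamX_lt1 n0.
have v0 := lamX_gt0 m; have v1 := lamX_lt1 m0.
have classify s : G (iter s T z) -> p < h (iter s T z) < q ->
    (p < h (iter s T z) < c /\ (0 < m)%N) \/
    (c < h (iter s T z) < q /\ (0 < n)%N).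
  move=> Gs hs; have := av _ Gs; rewrite neq_lt.
  by move=> /orP[hc|hc]; [left|right]; split=> //; lra.
exists N => k /subnK <-; elim: (k - N)%N => [|i [s [j [e Gs]]]].
  by exists N, 0%N; split=> //; exact: classify.
rewrite addSn e => -[[hs jm]|[hs jn]].
- have [jm'|jm'] := ltnP j.+1 m; first by exists s, j.+1; split=> //; left.
  have [Gm hm] := lr _ Gs hs.
  exists (m + s)%N, 0%N; split; [by rewrite add0n -addSn (eqP (_ : j.+1 == m))// eqn_leq jm|by rewrite iterD|].
  apply: classify; first by rewrite iterD.
  by rewrite iterD hm; case/andP: hs => ? ?; apply/andP; split; nra.
- have [jm'|jm'] := ltnP j.+1 n; first by exists s, j.+1; split=> //; right.
  have [Gm hm] := rr _ Gs hs.
  exists (n + s)%N, 0%N; split; [by rewrite add0n -addSn (eqP (_ : j.+1 == n))// eqn_leq jn|by rewrite iterD|].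
  apply: classify; first by rewrite iterD.
  by rewrite iterD hm; case/andP: hs => ? ?; apply/andP; split; nra.
Qed.

(** An excursion of one orbit is repeated by any other orbit at its later visits
    to the same side, with an error that does not exceed the distance between
    the starting points. *)
Lemma renorm_shadows h c G p q m n d z w : renorm h c G p q m n ->
  (forall w w', G w -> G w' -> `|w - w'| <= `|h w - h w'| + d) ->
  G z -> G w -> shadows (q - p + d) z w.
Proof.
move=> rn Gd Gz Gw; have [N HN] := renorm_parse rn Gz.
exists N => k /HN[s [j [-> Gs]]] side M.
case: side => -[hs jm].
- have [t Mt [Gt ht]] := renorm_left_late M rn Gw.
  exists (j + t)%N; first exact: leq_trans Mt (leq_addl _ _).
  have := renorm_left_coupled rn Gs Gt hs ht; rewrite !iterD => cpl.
  apply: le_trans (coupled_le1 cpl (ltnW jm)) _.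
  apply: le_trans (Gd _ _ Gs Gt) _; apply: lerD => //.
  by have := renorm_cq rn; rewrite ler_norml; lra.
- have [t Mt [Gt ht]] := renorm_right_late M rn Gw.
  exists (j + t)%N; first exact: leq_trans Mt (leq_addl _ _).
  have := renorm_right_coupled rn Gs Gt hs ht; rewrite !iterD => cpl.
  apply: le_trans (coupled_le1 cpl (ltnW jm)) _.
  apply: le_trans (Gd _ _ Gs Gt) _; apply: lerD => //.
  by have := renorm_pc rn; rewrite ler_norml; lra.
Qed.

(** The sets G eta shrink to the image of e when eta tends to 0.  The limiting
    one-dimensional dynamics takes place on that curve, which the orbits under
    study need not meet; hence the detour through neighbourhoods. *)
Record infinitely_renormalizable (h : V -> R) (c : R) (e : R -> V)
    (G : R -> set V) (z : V) : Prop := InfinitelyRenormalizable {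
  ir_isometry : forall r s, `|e r - e s| = `|r - s|;
  ir_flat : forall eta w, G eta w -> `|w - e (h w)| <= eta;
  ir_mono : forall eta eta', eta <= eta' -> G eta `<=` G eta';
  ir_reach : forall eta, 0 < eta -> exists i, G eta (iter i T z);
  ir_deep : forall d, 0 < d -> exists p q m n, q - p < d /\
    forall eta, 0 < eta -> renorm h c (G eta) p q m n }.

Lemma infinitely_renormalizable_opp h c e G z :
  infinitely_renormalizable h c e G z ->
  infinitely_renormalizable (\- h) (- c) (fun r => e (- r)) G z.
Proof.
case=> iso flat mono reach deep; split=> //.
- by move=> r s; rewrite iso -normrN; congr (`| _ |); ring.
- by move=> eta w /flat /=; rewrite opprK.
- move=> d /deep[p [q [m [n [pq rn]]]]]; exists (- q), (- p), n, m.
  by split=> [|eta /rn/renorm_opp]; first lra.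
Qed.

(** A sufficiently deep renormalisation interval contains c and is as short as
    desired, and its left side is visited at arbitrarily late times. *)
Lemma left_near_break h c e G z p eta d M :
  infinitely_renormalizable h c e G z -> p < c -> 0 < eta -> 0 < d ->
  exists2 t, (M <= t)%N &
    [/\ G eta (iter t T z), p < h (iter t T z) < c & c - h (iter t T z) < d].
Proof.
move=> [iso flat mono reach deep] pc eta0 d0.
have d'0 : 0 < Num.min d (c - p) by rewrite lt_min d0; lra.
have [p' [q' [m' [n' [pq' /(_ _ eta0) rn]]]]] := deep _ d'0.
have [i Gi] := reach _ eta0.
have [t Mt [Gt ht]] := renorm_left_late M rn Gi.
have cq := renorm_cq rn; move: pq'; rewrite lt_min => /andP[pq1 pq2].
by exists (t + i)%N; [exact: leq_trans Mt (leq_addr _ _)|rewrite iterD; split=> //; lra].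
Qed.

Lemma right_near_break h c e G z q eta d M :
  infinitely_renormalizable h c e G z -> c < q -> 0 < eta -> 0 < d ->
  exists2 t, (M <= t)%N &
    [/\ G eta (iter t T z), c < h (iter t T z) < q & h (iter t T z) - c < d].
Proof.
move=> /infinitely_renormalizable_opp ir cq eta0 d0.
have [|t Mt [Gt /= ht1 ht2]] := @left_near_break _ _ _ _ _ (- q) _ _ M ir _ eta0 d0.
  by lra.
by exists t => //; split=> //; lra.
Qed.

(** Since p is the limit of the right branch at the break, an orbit close to c
    on the right next returns close to p. *)
Lemma left_near_end h c e G z p q m n eta d M :
  infinitely_renormalizable h c e G z ->
  renorm h c (G eta) p q m n -> 0 < eta -> 0 < d ->
  exists2 t, (M <= t)%N &
    [/\ G eta (iter t T z), p < h (iter t T z) < c & h (iter t T z) - p < d].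
Proof.
move=> ir rn eta0 d0; have pc := renorm_pc rn.
have d'0 : 0 < Num.min d (c - p) by rewrite lt_min d0; lra.
have [t Mt [Gt ht]] := right_near_break M ir (renorm_cq rn) eta0 d'0.
rewrite lt_min => /andP[hd hc].
have [Gn hn] := renorm_right_return rn Gt ht.
have u0 := lamX_gt0 n; have u1 := lamX_lt1 (renorm_n rn).
exists (n + t)%N; first exact: leq_trans Mt (leq_addl _ _).
case/andP: ht => ht1 ht2.
by rewrite iterD; split=> //; rewrite hn; [apply/andP; split|]; nra.
Qed.

(** On the left side, the first m iterates are affine with linear part a power of
    -lam.  The points below are the values of their extensions at the two ends
    of the side, which the orbit of z approaches. *)
Lemma left_end_in_omega h c e G z p q m n eta w j r :
  infinitely_renormalizable h c e G z ->
  (forall eta, 0 < eta -> renorm h c (G eta) p q m n) ->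
  0 < eta -> G eta w -> p < h w < c -> (j <= m)%N -> r = p \/ r = c ->
  omega_limit T z (iter j T w + (- lam) ^+ j *: (e r - w)).
Proof.
move=> ir rn eta0 Gw hw jm rE; apply/omega_limitP => eps e0 M.
have e30 : 0 < eps / 3 by rewrite divr_gt0.
have eta'0 : 0 < Num.min eta (eps / 3) by rewrite lt_min eta0.
have pc := renorm_pc (rn _ eta0).
have [t Mt [Gt ht rt]] : exists2 t, (M <= t)%N &
    [/\ G (Num.min eta (eps / 3)) (iter t T z), p < h (iter t T z) < c &
        `|h (iter t T z) - r| < eps / 3].
  case: rE => ->.
    have [t Mt [Gt ht rt]] := left_near_end M ir (rn _ eta'0) eta'0 e30.
    by exists t => //; split=> //; rewrite ger0_norm; lra.
  have [t Mt [Gt ht rt]] := left_near_break M ir pc eta'0 e30.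
  by exists t => //; split=> //; rewrite ler0_norm; lra.
have Gt' : G eta (iter t T z).
  by apply: (ir_mono ir) Gt; rewrite ge_min lexx.
have flat : `|iter t T z - e (h (iter t T z))| <= eps / 3.
  by apply: le_trans (ir_flat ir Gt) _; rewrite ge_min lexx orbT.
have := renorm_left_coupled (rn _ eta0) Gt' Gw ht hw jm.
move=> /(canRL (subrK _)) cpl; exists (j + t)%N; first exact: leq_trans Mt (leq_addl _ _).
rewrite iterD cpl.
have -> : iter j T w + (- lam) ^+ j *: (e r - w) -
    ((- lam) ^+ j *: (iter t T z - w) + iter j T w) =
    (- lam) ^+ j *: (e r - iter t T z).
  rewrite [_ + iter j T w]addrC opprD addrACA subrr add0r -scalerBr.
  by congr (_ *: _); rewrite opprB addrA subrK.
rewrite normrZ normrX normrN gtr0_norm//.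
have l1 : lam ^+ j <= 1 by apply: exprn_ile1; exact: ltW.
apply: le_lt_trans (_ : `|e r - iter t T z| < _).
  by apply: ler_piMl.
rewrite distrC; apply: le_lt_trans (ler_distD (e (h (iter t T z))) _ _) _.
by rewrite (ir_isometry ir); lra.
Qed.

Lemma left_two_limits h c e G z p q m n eta w j :
  infinitely_renormalizable h c e G z ->
  (forall eta, 0 < eta -> renorm h c (G eta) p q m n) ->
  0 < eta -> G eta w -> p < h w < c -> (j <= m)%N ->
  exists x y, [/\ omega_limit T z x, omega_limit T z y, x != y,
    `|x - iter j T w| <= eta + (q - p) & `|y - iter j T w| <= eta + (q - p)].
Proof.
move=> ir rn eta0 Gw hw jm.
have pc := renorm_pc (rn _ eta0); have cq := renorm_cq (rn _ eta0).
have near r : r = p \/ r = c ->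
    `|iter j T w + (- lam) ^+ j *: (e r - w) - iter j T w| <= eta + (q - p).
  move=> rE; rewrite addrC addKr normrZ normrX normrN gtr0_norm//.
  have l1 : lam ^+ j <= 1 by apply: exprn_ile1; exact: ltW.
  apply: le_trans (_ : `|e r - w| <= _); first by apply: ler_piMl.
  rewrite distrC; apply: le_trans (ler_distD (e (h w)) _ _) _.
  apply: lerD; first exact: (ir_flat ir).
  by rewrite (ir_isometry ir) ler_norml; case: rE => ->; lra.
exists (iter j T w + (- lam) ^+ j *: (e p - w)),
  (iter j T w + (- lam) ^+ j *: (e c - w)); split.
- by apply: (left_end_in_omega ir rn eta0) => //; left.
- by apply: (left_end_in_omega ir rn eta0) => //; right.
- apply/eqP => /addrI /scalerI; rewrite expf_neq0 ?oppr_eq0 ?gt_eqF// => /(_ isT).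
  move=> /addIr epc; have := ir_isometry ir p c.
  by rewrite epc subrr normr0 => /esym/eqP; rewrite normr_eq0; lra.
- by apply: near; left.
- by apply: near; right.
Qed.

(** A limit point is close to an iterate of a short side, and such an iterate has
    two limit points nearby, at most one of which is the given one. *)
Lemma infinitely_renormalizable_perfect h c e G z x eps :
  infinitely_renormalizable h c e G z -> omega_limit T z x -> 0 < eps ->
  exists y, [/\ omega_limit T z y, y != x & `|x - y| < eps].
Proof.
move=> ir /omega_limitP xz e0.
have e40 : 0 < eps / 4 by rewrite divr_gt0.
have [p [q [m [n [pq rn]]]]] := ir_deep ir e40.
have [i Gi] := ir_reach ir e40.
have [N HN] := renorm_parse (rn _ e40) Gi.
have [k Nk xk] := xz _ e40 (N + i)%N.
have [|s [j [kE Gs side]]] := HN (k - i)%N; first by rewrite leq_subRL ?(leq_trans _ Nk) ?leq_addl// addnC.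
rewrite -iterD in Gs side.
have {kE} kE : iter k T z = iter j T (iter (s + i) T z).
  by rewrite -iterD; congr (iter _ T z); rewrite addnA -kE subnK// (leq_trans _ Nk)// leq_addl.
(* The right side is treated as the left one of the reflected coordinate. *)
have [y1 [y2 [oy1 oy2 y12 d1 d2]]] :
    exists x y, [/\ omega_limit T z x, omega_limit T z y, x != y,
      `|x - iter k T z| <= eps / 4 + (q - p) &
      `|y - iter k T z| <= eps / 4 + (q - p)].
  rewrite kE; case: side => -[hs /ltnW jm].
    exact: (left_two_limits ir rn).
  have irN := infinitely_renormalizable_opp ir.
  have := left_two_limits irN (fun eta eta0 => renorm_opp (rn eta eta0)) e40 Gs _ jm.
  have -> : - p - - q = q - p by ring.
  by move=> ends; apply: ends => /=; lra.
have close y : `|y - iter k T z| <= eps / 4 + (q - p) -> `|x - y| < eps.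
  move=> d; apply: le_lt_trans (ler_distD (iter k T z) _ _) _.
  by rewrite [X in _ + X]distrC; lra.
have [y1x|y1x] := eqVneq y1 x; last by exists y1; split=> //; exact: close.
by exists y2; split=> //; [rewrite eq_sym -y1x|exact: close].
Qed.

Lemma geometric_sum_le k :
  \sum_(j <- iota 0 k) lam ^+ j <= (1 - lam)^-1.
Proof.
have l10 : 0 < 1 - lam by rewrite subr_gt0.
rewrite -[leRHS]mul1r ler_pdivlMr//.
suff -> : (\sum_(j <- iota 0 k) lam ^+ j) * (1 - lam) = 1 - lam ^+ k.
  by rewrite gerBl exprn_ge0// ltW.
elim: k => [|k IH]; first by rewrite big_nil mul0r expr0 subrr.
by rewrite -addn1 iotaD big_cat/= big_seq1 mulrDl IH add0n addn1 exprS; ring.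
Qed.

End Dynamics.

(** * Projections of the limit set contain no interval *)

(** By subadditivity of the Lebesgue measure. *)
Lemma interval_cover (R : realType) (s : seq (R * R)) (u v : R) :
  (forall i, i \in s -> 0 <= i.2) ->
  (forall x, u < x < v -> exists2 i, i \in s & `|x - i.1| <= i.2) ->
  v - u <= \sum_(i <- s) 2 * i.2.
Proof.
move=> s0 cover.
have sum0 : 0 <= \sum_(i <- s) 2 * i.2.
  by rewrite big_seq; apply: sumr_ge0 => i /s0; lra.
have [vu|uv] := leP v u; first by lra.
pose F := \big[setU/set0]_(i <- s) `[i.1 - i.2, i.1 + i.2]%classic.
have [mF leF] : measurable F /\
    (lebesgue_measure F <= (\sum_(i <- s) 2 * i.2)%:E)%E.
  rewrite /F; elim: s s0 {cover sum0 F} => [|i s IH] s0.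
    by rewrite !big_nil measure0; split.
  have [|mF leF] := IH; first by move=> j js; apply: s0; rewrite in_cons js orbT.
  rewrite !big_cons; split; first exact: measurableU.
  apply: le_trans (measureU2 _ _ _) _ => //.
  rewrite EFinD; apply: leeD => //.
  have := s0 i; rewrite mem_head => /(_ isT) i0.
  have lei : (lebesgue_measure (`[(i.1 - i.2)%R, (i.1 + i.2)%R]%classic : set R)
      <= (2 * i.2)%:E)%E.
    by rewrite lebesgue_measure_itv /= lte_fin; case: ifP => _; rewrite lee_fin; lra.
  exact: lei.
have : (lebesgue_measure `]u, v[%classic <= lebesgue_measure F)%E.
  apply: le_measure; rewrite ?inE//.
  move=> x; rewrite /= in_itv /= => /cover[i si xi].
  rewrite /F -bigcup_seq; exists i => //=.
  by rewrite in_itv /=; move: xi; rewrite ler_norml; lra.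
rewrite lebesgue_measure_itv /= lte_fin uv => /le_trans/(_ leF).
by rewrite lee_fin.
Qed.

(** The limit set is covered by the images of a short interval along one
    excursion of each kind.  Their diameters form two geometric progressions, so
    that their sum is at most a constant times the length of the interval. *)
Lemma infinitely_renormalizable_gap (R : realType) (V : normedModType R)
    (T : V -> V) (lam : R) h c e G z (f : V -> R) u v :
  0 < lam < 1 -> infinitely_renormalizable T lam h c e G z ->
  (forall x y, `|f x - f y| <= `|x - y|) -> u < v ->
  exists2 t, u < t < v & forall x, omega_limit T z x -> f x != t.
Proof.
move=> lam01 ir f1 uv; have /andP[lam0 lam1] := lam01.
have l10 : 0 < 1 - lam by rewrite subr_gt0.
(* The intervals below have half-length 3 d lam^j; over the two excursions their
   lengths add up to at most 12 d / (1 - lam), which is less than v - u. *)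
pose d := (v - u) * (1 - lam) / 13.
have d0 : 0 < d by rewrite divr_gt0// mulr_gt0// subr_gt0.
have [p [q [m [n [pq /(_ _ d0) rn]]]]] := ir_deep ir d0.
have [i Gi] := ir_reach ir d0.
have [N HN] := renorm_parse lam01 rn Gi.
have [a _ [Ga ha]] := renorm_left_late lam01 0 rn Gi.
have [b _ [Gb hb]] := renorm_right_late lam01 0 rn Gi.
pose s := [seq (f (iter j T (iter a T (iter i T z))), lam ^+ j * (3 * d)) | j <- iota 0 m]
  ++ [seq (f (iter j T (iter b T (iter i T z))), lam ^+ j * (3 * d)) | j <- iota 0 n].
pose F := \big[setU/set0]_(i <- s) (f @^-1` `[i.1 - i.2, i.1 + i.2]%classic).
have cf : continuous f.
  move=> x; apply/cvgrPdist_lt => eps e0.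
  have := nbhsx_ballx x _ e0; apply: filterS => y; rewrite -ball_normE /=.
  exact: le_lt_trans.
have oF : omega_limit T z `<=` F.
  apply: (@omega_limit_sub_closed _ _ _ _ _ (N + i)%N).
    apply: closed_bigsetU => j _; apply: preimage_closed => //.
    exact: itv_closed.
  move=> k Nk; have [|t [j [kE Gt side]]] := HN (k - i)%N; first by rewrite leq_subRL ?(leq_trans _ Nk) ?leq_addl// addnC.
  have kE' : iter k T z = iter j T (iter t T (iter i T z)).
    by rewrite -!iterD; congr (iter _ T z); rewrite -kE subnK// (leq_trans _ Nk)// leq_addl.
  have near w : G d w -> `|h (iter t T (iter i T z)) - h w| <= q - p ->
      `|iter t T (iter i T z) - w| <= 3 * d.
    move=> Gw hd; apply: le_trans (ler_distD (e (h (iter t T (iter i T z)))) _ _) _.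
    have fl := ir_flat ir Gt; have fl' := ir_flat ir Gw.
    have tri := ler_distD (e (h w)) (e (h (iter t T (iter i T z)))) w.
    by move: tri; rewrite (ir_isometry ir) [`|e (h w) - w|]distrC; lra.
  have pc := renorm_pc rn; have cq := renorm_cq rn.
  rewrite /F -bigcup_seq kE'; case: side => -[ht jm].
  - exists (f (iter j T (iter a T (iter i T z))), lam ^+ j * (3 * d)) => /=.
      rewrite mem_cat; apply/orP; left; apply/mapP; exists j => //.
      by rewrite mem_iota add0n jm.
    have := coupled_le lam01 (renorm_left_coupled rn Gt Ga ht ha) (ltnW jm).
    have hd : `|h (iter t T (iter i T z)) - h (iter a T (iter i T z))| <= q - p.
      by rewrite ler_norml; lra.
    have nr := ler_wpM2l (ltW (exprn_gt0 j lam0)) (near _ Ga hd).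
    move=> /(le_trans (f1 _ _))/le_trans/(_ nr).
    by rewrite ler_norml in_itv /=; lra.
  - exists (f (iter j T (iter b T (iter i T z))), lam ^+ j * (3 * d)) => /=.
      rewrite mem_cat; apply/orP; right; apply/mapP; exists j => //.
      by rewrite mem_iota add0n jm.
    have := coupled_le lam01 (renorm_right_coupled rn Gt Gb ht hb) (ltnW jm).
    have hd : `|h (iter t T (iter i T z)) - h (iter b T (iter i T z))| <= q - p.
      by rewrite ler_norml; lra.
    have nr := ler_wpM2l (ltW (exprn_gt0 j lam0)) (near _ Gb hd).
    move=> /(le_trans (f1 _ _))/le_trans/(_ nr).
    by rewrite ler_norml in_itv /=; lra.
apply: contrapT => nogap.
have : v - u <= \sum_(i <- s) 2 * i.2.
  apply: interval_cover.
    have pos j : 0 <= lam ^+ j * (3 * d) by rewrite mulr_ge0 ?exprn_ge0 ?(ltW lam0)//; lra.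
    by move=> k; rewrite mem_cat => /orP[] /mapP[j _ ->]; exact: pos.
  move=> t uvt; apply: contrapT => out; apply: nogap; exists t => // x /oF.
  rewrite /F -bigcup_seq => -[k sk /=]; rewrite in_itv /= => fk.
  by apply/eqP => ft; apply: out; exists k => //; rewrite ler_norml; lra.
rewrite big_cat !big_map /=.
have sumE k : \sum_(j <- iota 0 k) 2 * (lam ^+ j * (3 * d)) <= 6 * d / (1 - lam).
  have -> : \sum_(j <- iota 0 k) 2 * (lam ^+ j * (3 * d)) =
      6 * d * \sum_(j <- iota 0 k) lam ^+ j.
    by rewrite mulr_sumr; apply: eq_bigr => j _; ring.
  by apply: ler_wpM2l; [lra|exact: geometric_sum_le].
have := sumE m; have := sumE n.
have -> : 6 * d / (1 - lam) = 6 / 13 * (v - u).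
  by rewrite /d; field; rewrite gt_eqF.
lra.
Qed.

(** * A criterion for Cantor sets, and the middle-thirds set *)

Lemma compact_set_type (X : topologicalType) (K : set X) :
  compact K -> compact [set: K].
Proof.
move=> cK F PF _.
have KF : (set_val @ F) K by apply: nearW => -[x xK] /=; exact: set_mem.
have [x [Kx clx]] := cK _ _ KF.
exists (exist _ x (mem_set Kx)); split=> // A B FA [_ [[W oW <-] Wx WB]].
have FA' : (set_val @ F) ((set_val : K -> X) @` A).
  by apply: (@filterS _ F _ A) FA => a Aa; exists a.
have [_ [[a Aa <-] Wa]] := clx _ W FA' (open_nbhs_nbhs (conj oW Wx)).
by exists a; split=> //; exact: WB.
Qed.

(** The subspace K is compact, perfect and zero-dimensional, hence homeomorphic
    to the Cantor space.  The homeomorphism is exposed as a pair of maps defined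
    on the ambient spaces, which makes two such sets easy to compare. *)
Lemma cantor_criterion (R : realType) (X : pseudoMetricType R) (K : set X) :
  hausdorff_space X -> K !=set0 -> compact K ->
  (forall x U, K x -> nbhs x U -> exists y, [/\ K y, U y & y != x]) ->
  (forall x y, K x -> K y -> x != y -> exists U V : set X,
    [/\ open U, open V, U x /\ V y, K `<=` U `|` V &
        forall w, K w -> U w -> V w -> False]) ->
  exists (f : cantor_space -> X) (g : X -> cantor_space),
    [/\ forall s, K (f s), cancel f g, {in K, cancel g f},
        continuous f & {within K, continuous g}].
Proof.
move=> hX [x0 Kx0] cK perfK sepK.
pose p0 : K := exist _ x0 (mem_set Kx0).
pose KP := isPointed.Build (set_type K) p0.
pose T : pseudoPMetricType R := HB.pack (set_type K) KP.
have nbhsT (x : T) (U : set X) : nbhs (set_val x) U -> nbhs x (set_val @^-1` U).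
  move=> nU; exact: (@initial_continuous K X set_val x U nU).
have openT (U : set X) : open U -> open (set_val @^-1` U : set T).
  by move=> oU; exists U.
have KT (x : T) : K (set_val x) by exact: set_valP.
have TE (x : T) y (Ky : K y) : set_val x = y -> x = exist _ y (mem_set Ky).
  by move=> xy; apply/val_inj.
have cantT : cantor_like T.
  split.
  - apply/perfectTP => x [W oW WE].
    have Wx : W (set_val x) by rewrite -[W _]/((set_val @^-1` W) x) WE.
    have [y [Ky Wy /eqP]] :=
      perfK _ _ (KT x) (open_nbhs_nbhs (conj oW Wx)).
    apply; have : (set_val @^-1` W) (exist _ y (mem_set Ky) : K) by [].
    by rewrite WE => <-.
  - exact: compact_set_type.
  - move=> x y clxy; apply: val_inj; apply: hX => A B nA nB.
    have [z [Az Bz]] := clxy _ _ (nbhsT _ _ nA) (nbhsT _ _ nB).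
    by exists (set_val z).
  - move=> x y xy; have xy' : set_val x != set_val y.
      by apply: contra xy => /eqP/val_inj/eqP.
    have [U [V [oU oV [Ux Vy] KUV UV]]] := sepK _ _ (KT x) (KT y) xy'.
    exists (set_val @^-1` U); split=> //.
      split; first exact: openT.
      have -> : set_val @^-1` U = ~` (set_val @^-1` V : set T).
        apply/seteqP; split=> z /=; first by move=> Uz Vz; exact: (UV _ (KT z)).
        by move=> nV; have [] := KUV _ (KT z).
      by apply: open_closedC; exact: openT.
    by move=> Uy; exact: (UV _ (KT y)).
have [h [ch clh]] := homeomorphism_cantor_like cantT.
have hI : continuous (h^-1%FUN : T -> cantor_space).
  apply/continuous_closedP => A cA.
  suff -> : h^-1%FUN @^-1` A = [set h x | x in A] by exact: clh.
  apply/seteqP; split=> y /=.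
    by move=> Ay; exists (h^-1%FUN y) => //; apply: invK; rewrite inE.
  by move=> [x Ax <-]; rewrite funK ?inE.
have gE (x : K) : valL_ point (h^-1%FUN : K -> cantor_space) (set_val x) =
    h^-1%FUN x by exact: (congr1 (fun u => u x) (valLK _ _)).
exists (set_val \o h), (valL_ point (h^-1%FUN : K -> cantor_space)); split.
- by move=> s; exact: KT.
- by move=> s; rewrite /comp gE funK ?inE.
- move=> x /set_mem Kx; pose x' : K := exist _ x (mem_set Kx).
  change (set_val (h (valL_ point (h^-1%FUN : K -> cantor_space) (set_val x')))
    = set_val x'); rewrite gE.
  by rewrite invK ?inE.
- move=> s; apply: continuous_comp; first exact: ch.
  exact: initial_continuous.
- exact/subspace_valL_continuousP'.
Qed.

Lemma cantor_criterion_homeomorphic (R : realType) (X Y : pseudoMetricType R)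
    (K : set X) (L : set Y) :
  (exists (f : cantor_space -> X) (g : X -> cantor_space),
    [/\ forall s, K (f s), cancel f g, {in K, cancel g f},
        continuous f & {within K, continuous g}]) ->
  (exists (f : cantor_space -> Y) (g : Y -> cantor_space),
    [/\ forall s, L (f s), cancel f g, {in L, cancel g f},
        continuous f & {within L, continuous g}]) ->
  homeomorphic_sets K L.
Proof.
move=> [f [g [fK fgK gfK cf cg]]] [f' [g' [fL fgL gfL cf' cg']]].
exists (f' \o g), (f \o g'); split.
- by move=> x _; exact: fL.
- by move=> x _; exact: fK.
- by split=> x Kx /=; rewrite ?fgL ?fgK ?gfK ?gfL.
- by apply: within_continuous_comp => // x _; exact: cf'.
- by apply: within_continuous_comp => // x _; exact: cf.
Qed.

Section MiddleThirds.
Variable R : realType.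

Let thirds (C : set R) : set R :=
  (fun t => t / 3) @` C `|` (fun t => (t + 2) / 3) @` C.
Let stage n : set R := iter n thirds `[0, 1]%classic.

Let stage01 n t : stage n t -> 0 <= t <= 1.
Proof.
elim: n t => [t|n IH t]; first by rewrite /stage /= in_itv.
by move=> [] [s /IH s01 <-]; lra.
Qed.

Let stageS n t : stage n.+1 t ->
  (t <= 1 / 3 /\ stage n (3 * t)) \/ (2 / 3 <= t /\ stage n (3 * t - 2)).
Proof.
move=> [] [s sn <-]; have s01 := stage01 sn; [left|right]; split; try lra.
  by rewrite mulrC divfK.
by rewrite (_ : 3 * _ - 2 = s)//; field.
Qed.

Let middle_thirdsE t : @middle_thirds R t <-> forall n, stage n t.
Proof. by split=> H n; [exact: H|move=> _; exact: H]. Qed.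

(** The self-similarity of the set, from which its two topological properties
    follow by induction on the scale. *)
Let middle_thirdsP t : @middle_thirds R t ->
  (t <= 1 / 3 /\ @middle_thirds R (3 * t)) \/
  (2 / 3 <= t /\ @middle_thirds R (3 * t - 2)).
Proof.
move=> /middle_thirdsE Mt.
have [t13|t13] := leP t (1 / 3); [left|right]; split => //.
- by apply/middle_thirdsE => n; case: (stageS (Mt n.+1)) => -[] //; lra.
- by case: (stageS (Mt 1%N)) => -[] //; lra.
- by apply/middle_thirdsE => n; case: (stageS (Mt n.+1)) => -[] //; lra.
Qed.

Let middle_thirds_left t : @middle_thirds R t -> @middle_thirds R (t / 3).
Proof.
move=> /middle_thirdsE Mt; apply/middle_thirdsE => -[|n].
  by have := stage01 (Mt 0%N); rewrite /stage /= in_itv /=; lra.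
by left; exists t.
Qed.

Let middle_thirds_right t : @middle_thirds R t -> @middle_thirds R ((t + 2) / 3).
Proof.
move=> /middle_thirdsE Mt; apply/middle_thirdsE => -[|n].
  by have := stage01 (Mt 0%N); rewrite /stage /= in_itv /=; lra.
by right; exists t.
Qed.

Let middle_thirds0 : @middle_thirds R 0.
Proof.
apply/middle_thirdsE; elim=> [|n IH]; first by rewrite /stage /= in_itv /=; lra.
by left; exists 0 => //; rewrite mul0r.
Qed.

Let middle_thirds1 : @middle_thirds R 1.
Proof.
apply/middle_thirdsE; elim=> [|n IH]; first by rewrite /stage /= in_itv /=; lra.
by right; exists 1 => //; field.
Qed.

Let middle_thirds_compact : compact (@middle_thirds R).
Proof.
have cstage n : compact (stage n).
  elim: n => [|n IH]; first exact: segment_compact.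
  apply: compactU; apply: continuous_compact => //.
    by apply: continuous_subspaceT => x; apply: cvgMl; exact: cvg_id.
  apply: continuous_subspaceT => x; apply: cvgMl; apply: cvgD; first exact: cvg_id.
  exact: cvg_cst.
apply: (subclosed_compact _ (cstage 0%N)).
  apply: closed_bigI => n _; apply: compact_closed => //.
  exact: cstage.
by move=> t /middle_thirdsE Mt; exact: (Mt 0%N).
Qed.

Let middle_thirds_limit_point n x : @middle_thirds R x ->
  exists y, [/\ @middle_thirds R y, y != x & `|x - y| <= 3^-1 ^+ n].
Proof.
elim: n x => [x Mx|n IH x Mx].
  have := stage01 ((middle_thirdsE x).1 Mx 0%N); rewrite expr0 => x01.
  have [->|x0] := eqVneq x 0.
    by exists 1; split=> //; rewrite ?oner_eq0// sub0r normrN normr1.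
  exists 0; split=> //; first by rewrite eq_sym.
  by rewrite subr0 ger0_norm; lra.
have [[x13 /IH[y [My yx xy]]]|[x13 /IH[y [My yx xy]]]] := middle_thirdsP Mx.
- exists (y / 3); split; first exact: middle_thirds_left.
    by apply: contra yx => /eqP yx; apply/eqP; lra.
  rewrite exprS (_ : x - y / 3 = 3^-1 * (3 * x - y)); last by field.
  by rewrite normrM ger0_norm ?invr_ge0// ler_wpM2l// invr_ge0.
- exists ((y + 2) / 3); split; first exact: middle_thirds_right.
    by apply: contra yx => /eqP yx; apply/eqP; lra.
  rewrite exprS (_ : x - (y + 2) / 3 = 3^-1 * (3 * x - 2 - y)); last by field.
  by rewrite normrM ger0_norm ?invr_ge0// ler_wpM2l// invr_ge0.
Qed.

Let middle_thirds_gap n x y : @middle_thirds R x -> @middle_thirds R y ->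
  3^-1 ^+ n < y - x -> exists2 t, x < t < y & ~ @middle_thirds R t.
Proof.
elim: n x y => [x y Mx My|n IH x y Mx My].
  have := stage01 ((middle_thirdsE x).1 Mx 0%N).
  have := stage01 ((middle_thirdsE y).1 My 0%N); rewrite expr0.
  by move=> *; exfalso; lra.
rewrite exprS => xy.
have e0 : 0 < 3^-1 ^+ n :> R by rewrite exprn_gt0// invr_gt0.
have [[x13 Mx']|[x13 Mx']] := middle_thirdsP Mx;
  have [[y13 My']|[y13 My']] := middle_thirdsP My; last 1 first.
- have [|t xty Mt] := IH _ _ Mx' My'; first by lra.
  exists ((t + 2) / 3) => [|/middle_thirdsP]; first by lra.
  move=> [[? _]|[_]]; first by lra.
  by rewrite (_ : 3 * _ - 2 = t)//; field.
- have [|t xty Mt] := IH _ _ Mx' My'; first by lra.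
  exists (t / 3) => [|/middle_thirdsP]; first by lra.
  move=> [[_]|[? _]]; last by lra.
  by rewrite (_ : 3 * _ = t)//; field.
- exists (1 / 2); first by lra.
  by move=> /middle_thirdsP[[? _]|[? _]]; lra.
- by exfalso; lra.
Qed.

Lemma geometric_lt (r e : R) : 0 <= r < 1 -> 0 < e -> exists n, r ^+ n < e.
Proof.
move=> /andP[r0 r1] e0.
have /cvgrPdist_lt/(_ _ e0)[n _ /(_ n (leqnn n))] : r ^+ j @[j --> \oo] --> (0 : R).
  by apply: cvg_expr; rewrite ger0_norm.
by rewrite sub0r normrN normrX ger0_norm//; exists n.
Qed.

Lemma middle_thirds_cantor :
  exists (f : cantor_space -> R) (g : R -> cantor_space),
    [/\ forall s, @middle_thirds R (f s), cancel f g,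
        {in @middle_thirds R, cancel g f},
        continuous f & {within @middle_thirds R, continuous g}].
Proof.
apply: cantor_criterion ; [exact: Rhausdorff| |by []| |].
- by exists 0.
- move=> x U Mx /nbhs_ballP[e /= e0 eU].
  have [|n ne] := @geometric_lt 3^-1 e _ e0; first lra.
  have [y [My yx xy]] := middle_thirds_limit_point n Mx.
  exists y; split=> //; apply: eU; rewrite -ball_normE /=.
  exact: le_lt_trans ne.
- move=> x y Mx My xy.
  wlog lt_xy : x y Mx My xy / x < y.
    move=> H; have := xy; rewrite neq_lt => /orP[|yx]; first exact: H.
    have [||U [V [oU oV [Uy Vx] MUV UV]]] := H y x My Mx; rewrite 1?eq_sym//.
    exists V, U; split=> //; first by rewrite setUC.
    by move=> w Mw Vw Uw; exact: (UV w).
  have [||n ne] := @geometric_lt 3^-1 (y - x); [lra|lra|].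
  have [t xty Mt] := middle_thirds_gap Mx My ne.
  exists [set w | w < t], [set w | t < w]; split.
  + exact: open_lt.
  + exact: open_gt.
  + by move=> /=; lra.
  + move=> w Mw; have : w != t by apply/eqP => wt; apply: Mt; rewrite -wt.
    by rewrite neq_lt => /orP[]; [left|right].
  + by move=> w _ /=; lra.
Qed.

End MiddleThirds.

(** * The four regions and the affine branches of the map *)

Section Quadrilateral.
Variables (R : realType) (a : R).
Hypothesis a_range : 2 / 5 <= a <= 1 / 2.

Let a_ge : 2 / 5 <= a. Proof. by case/andP: a_range. Qed.
Let a_gt0 : 0 < a. Proof. by apply: lt_le_trans a_ge; lra. Qed.
Let a_le : a <= 1 / 2. Proof. by case/andP: a_range. Qed.

Let b : R := 2 / 5.
Let P := quad a b.
Let T := quad_map a b.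

Lemma convex_setP (A : set (R * R)) : @convex_set R (R * R)%type A <->
  forall x y t, A x -> A y -> 0 <= t <= 1 ->
    A (t * x.1 + (1 - t) * y.1, t * x.2 + (1 - t) * y.2).
Proof.
split=> [cA x y t Ax Ay /andP[t0 t1]|cA x y t /set_mem Ax /set_mem Ay].
  by have := cA x y (Itv01 t0 t1) (mem_set Ax) (mem_set Ay); rewrite inE.
have := cA x y (t%:num) Ax Ay; rewrite inE; apply.
by rewrite ge0 le1.
Qed.

Lemma polygon_halfplane (n : nat) (A : 'I_n -> R * R) (u v w : R) :
  (forall i, 0 <= u * (A i).1 + v * (A i).2 + w) ->
  forall p, polygon A p -> 0 <= u * p.1 + v * p.2 + w.
Proof.
move=> HA; apply: smallest_sub.
  apply/convex_setP => x y t /= Hx Hy t01.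
  have t1 : 0 <= 1 - t by lra.
  have t0 : 0 <= t by lra.
  rewrite [leRHS](_ : _ = t * (u * x.1 + v * x.2 + w) +
    (1 - t) * (u * y.1 + v * y.2 + w)); last by ring.
  by rewrite addr_ge0// mulr_ge0.
by move=> _ [i _ <-].
Qed.

Lemma quadE i : P i = nth (0, 0) [:: (0, 1); (a, 1); (1, b); (0, 0)] i.
Proof. by rewrite /P /quad (tnth_nth (0, 0)). Qed.

(** Positive on the outer side of the line through the vertices (a, 1) and
    (1, b). *)
Definition bc_form (p : R * R) : R :=
  3 / 5 * (p.1 - 1) + (1 - a) * (p.2 - 2 / 5).

Definition region_a (p : R * R) := 0 < p.1 /\ 1 < p.2.
Definition region_b (p : R * R) := p.2 < 1 /\ 0 < bc_form p.
Definition region_c (p : R * R) := p.2 < 2 / 5 * p.1 /\ bc_form p < 0.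
Definition region_d (p : R * R) := p.1 < 0 /\ 2 / 5 * p.1 < p.2.
Definition region (p : R * R) :=
  [\/ region_a p, region_b p, region_c p | region_d p].

Lemma forall_I4 (Q : 'I_4 -> Prop) : Q (Ordinal (erefl : 0 < 4)%N) ->
  Q (Ordinal (erefl : 1 < 4)%N) -> Q (Ordinal (erefl : 2 < 4)%N) ->
  Q (Ordinal (erefl : 3 < 4)%N) -> forall i, Q i.
Proof.
by move=> Q0 Q1 Q2 Q3 [[|[|[|[|//]]]] i4]; rewrite (bool_irrelevance i4 erefl).
Qed.

Lemma rayP (u v p : R * R) : ray u v p <-> exists2 t, 0 <= t &
  p.1 = u.1 + t * (v.1 - u.1) /\ p.2 = u.2 + t * (v.2 - u.2).
Proof.
split=> -[t t0]; first by move=> ->; exists t.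
by case: p => p1 p2 /= [-> ->]; exists t.
Qed.

Lemma side_raysP p : side_rays P p <->
  [\/ p.2 = 1 /\ 0 <= p.1, bc_form p = 0 /\ p.2 <= 1,
      p.2 = 2 / 5 * p.1 /\ p.1 <= 1 | p.1 = 0 /\ 0 <= p.2].
Proof.
rewrite /bc_form; split.
  have := a_ge; have := a_le; move=> a1 a2 [i _]; elim/forall_I4: i; rewrite !quadE /= => /rayP[t t0 /= [-> ->]].
  - constructor 1; split; [ring|nra].
  - constructor 2; rewrite /b; split; [lra|nra].
  - constructor 3; rewrite /b; split; [lra|nra].
  - constructor 4; split; [ring|nra].
move=> [] [H1 H2].
- exists (Ordinal (erefl : 0 < 4)%N) => //; rewrite !quadE /=; apply/rayP.
  exists (p.1 / a); first by rewrite divr_ge0// ltW.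
  by rewrite /= subr0 add0r divfK ?gt_eqF// subrr mulr0 addr0.
- exists (Ordinal (erefl : 1 < 4)%N) => //; rewrite !quadE /=; apply/rayP.
  exists (5 / 3 * (1 - p.2)); first by lra.
  by rewrite /= /b; split; [lra|lra].
- exists (Ordinal (erefl : 2 < 4)%N) => //; rewrite !quadE /=; apply/rayP.
  by exists (1 - p.1); [lra|rewrite /= /b; split; lra].
- exists (Ordinal (erefl : 3 < 4)%N) => //; rewrite !quadE /=; apply/rayP.
  by exists p.2; [lra|rewrite /=; split; lra].
Qed.

Definition off_rays (p : R * R) := ~ side_rays P p.

Lemma region_off p : region p -> off_rays p.
Proof.
rewrite /bc_form => reg /side_raysP; rewrite /bc_form.
have a1 : 0 < 1 - a by have := a_le; lra.
case: reg => -[]; rewrite /bc_form => h1 h2 [] [h3 h4]; try lra.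
- have : 0 <= (1 - a) * (1 - p.1) by rewrite mulr_ge0//; lra.
  by rewrite h3 in h2; lra.
- have : 0 <= (1 - a) * (1 - p.2) by rewrite mulr_ge0//; lra.
  by rewrite h3 in h2; have := a_ge; lra.
- by rewrite h3 in h2; have := a_ge; lra.
- have : 0 <= (1 - a) * (1 - p.2) by rewrite mulr_ge0//; lra.
  by have := a_ge; lra.
Qed.

(** Off the rays, a point in none of the regions is in the interior of P. *)
Lemma off_regionP p : off_rays p ->
  region p \/ [/\ 0 < p.1, p.2 < 1, 2 / 5 * p.1 < p.2 & bc_form p < 0].
Proof.
rewrite /off_rays side_raysP => off.
have a1 : 0 < 1 - a by have := a_le; lra.
have off1 : p.2 = 1 -> p.1 < 0.
  by move=> h; rewrite ltNge; apply/negP => h'; apply: off; constructor 1.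
have off2 : bc_form p = 0 -> 1 < p.2.
  by move=> h; rewrite ltNge; apply/negP => h'; apply: off; constructor 2.
have off3 : p.2 = 2 / 5 * p.1 -> 1 < p.1.
  by move=> h; rewrite ltNge; apply/negP => h'; apply: off; constructor 3.
have off4 : p.1 = 0 -> p.2 < 0.
  by move=> h; rewrite ltNge; apply/negP => h'; apply: off; constructor 4.
rewrite /bc_form in off2 *.
have [x0|x0|x0] := ltrgtP p.1 0.
- have [dd|dd|dd] := ltrgtP p.2 (2 / 5 * p.1).
  + left; constructor 3; split=> //; rewrite /bc_form.
    have : 0 < (1 - a) * (- p.2) by rewrite mulr_gt0//; lra.
    by have := a_le; lra.
  + by left; constructor 4.
  + by have := off3 dd; lra.
- have [y1|y1|y1] := ltrgtP p.2 1; [|by left; constructor 1|by have := off1 y1; lra].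
  have [f0|f0|f0] := ltrgtP (bc_form p) 0; rewrite /bc_form in f0.
  + have [dd|dd|dd] := ltrgtP p.2 (2 / 5 * p.1).
    * by left; constructor 3.
    * by right.
    * have x1 := off3 dd.
      have : 0 < (1 - a) * (p.1 - 1) by rewrite mulr_gt0//; lra.
      by rewrite dd in f0; lra.
  + by left; constructor 2.
  + by have := off2 f0; lra.
- have y0 := off4 x0.
  left; constructor 3; split; rewrite /bc_form x0; first by lra.
  have : 0 < (1 - a) * (- p.2) by rewrite mulr_gt0//; lra.
  by have := a_le; lra.
Qed.

(** The point lies on a horizontal chord, which goes from the side on the
    vertical axis to one of the two sides through (1, 2/5). *)
Lemma polygon_inside p : 0 < p.1 -> p.2 < 1 -> 2 / 5 * p.1 < p.2 ->
  bc_form p < 0 -> polygon P p.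
Proof.
rewrite /bc_form => x0 y1 dd f0 A [/convex_setP cA PA].
have A0 : A (0, 1) by apply: PA; exists (Ordinal (erefl : 0 < 4)%N) => //; rewrite quadE.
have A1 : A (a, 1) by apply: PA; exists (Ordinal (erefl : 1 < 4)%N) => //; rewrite quadE.
have A2 : A (1, b) by apply: PA; exists (Ordinal (erefl : 2 < 4)%N) => //; rewrite quadE.
have A3 : A (0, 0) by apply: PA; exists (Ordinal (erefl : 3 < 4)%N) => //; rewrite quadE.
have AL : A (0, p.2).
  have := cA _ _ p.2 A0 A3; rewrite /= !mulr0 mulr1 !addr0; apply; lra.
have [r pr Ar] : exists2 r, p.1 <= r & A (r, p.2).
  have [y0|y0] := leP p.2 (2 / 5).
    exists (5 / 2 * p.2); first by lra.
    have := cA _ _ (5 / 2 * p.2) A2 A3; rewrite /= !mulr0 !addr0 mulr1 /b.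
    rewrite (_ : 5 / 2 * p.2 * (2 / 5) = p.2); last by field.
    by apply; lra.
  exists (5 / 3 * (1 - p.2) + (1 - 5 / 3 * (1 - p.2)) * a); first by lra.
  have := cA _ _ (5 / 3 * (1 - p.2)) A2 A1; rewrite /= !mulr1 /b.
  rewrite (_ : 5 / 3 * (1 - p.2) * (2 / 5) + (1 - 5 / 3 * (1 - p.2)) = p.2); last by field.
  by apply; lra.
have := cA _ _ (p.1 / r) Ar AL; rewrite /= mulr0 addr0 divfK; last by rewrite gt_eqF//; lra.
rewrite -mulrDl [p.1 / r + _]addrC subrK mul1r -surjective_pairing; apply.
have r0 : 0 < r by lra.
by rewrite divr_ge0 ?ler_pdivrMr ?(ltW x0) ?(ltW r0)//=; lra.
Qed.

Lemma left_ofP x v : (forall i, 0 <= (v.1 - x.1) * ((P i).2 - x.2) -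
    (v.2 - x.2) * ((P i).1 - x.1)) -> polygon P `<=` left_of x v.
Proof.
move=> H p Pp; rewrite /left_of /=.
have := @polygon_halfplane 4 P (x.2 - v.2) (v.1 - x.1)
  ((v.2 - x.2) * x.1 - (v.1 - x.1) * x.2) _ p Pp.
rewrite (_ : _ * p.1 + _ * p.2 + _ = (v.1 - x.1) * (p.2 - x.2) - (v.2 - x.2) * (p.1 - x.1)); last by ring.
by apply => i; have := H i; lra.
Qed.

Lemma polygon_vertex i : polygon P (P i).
Proof. by move=> A [_]; apply; exists i. Qed.

(** The tangent vertex is the rightmost one as seen from x, so that x and any
    other vertex span a ray that leaves it strictly on the right. *)
Lemma tangent_vertexE x i :
  (forall j, j != i -> 0 < ((P i).1 - x.1) * ((P j).2 - x.2) -
    ((P i).2 - x.2) * ((P j).1 - x.1)) ->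
  T x = (8 / 5 * (P i).1 - 3 / 5 * x.1, 8 / 5 * (P i).2 - 3 / 5 * x.2).
Proof.
move=> Hi; rewrite /T /quad_map /outer_billiard -/P.
suff -> : tangent_vertex P x = P i.
  by congr pair; rewrite /= /GRing.scale /= /b; field.
have Qi : [set v | range P v /\ polygon P `<=` left_of x v] (P i).
  split; [by exists i|apply: left_ofP => j].
  by have [->|/Hi/ltW//] := eqVneq j i; rewrite mulrC subrr.
have := getI Qi; rewrite -/(tangent_vertex P x) => -[[j _ <-] lj].
have [->//|/Hi pos] := eqVneq j i.
have := lj _ (polygon_vertex i); rewrite /left_of /= leNgt => /negP[].
by rewrite -oppr_gt0 opprB [ltRHS](_ : _ = ((P i).1 - x.1) * ((P j).2 - x.2) -
    ((P i).2 - x.2) * ((P j).1 - x.1)); last by ring.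
Qed.

Lemma map_region_a p : region_a p ->
  T p = (- (3 / 5) * p.1, 8 / 5 - 3 / 5 * p.2).
Proof.
move=> [h1 h2]; rewrite (@tangent_vertexE _ (Ordinal (erefl : 0 < 4)%N)).
  by rewrite quadE; congr pair => /=; rewrite /b; lra.
have h3 : 0 < a * (p.2 - 1) by rewrite mulr_gt0//; lra.
by elim/forall_I4 => // _; rewrite !quadE /= /b; lra.
Qed.

Lemma map_region_b p : region_b p ->
  T p = (8 / 5 * a - 3 / 5 * p.1, 8 / 5 - 3 / 5 * p.2).
Proof.
move=> [h1 h2]; rewrite (@tangent_vertexE _ (Ordinal (erefl : 1 < 4)%N)).
  by rewrite quadE; congr pair => /=; rewrite /b; lra.
move: h2; rewrite /bc_form => h2.
have : 0 < (1 - p.2) * a by rewrite mulr_gt0//; lra.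
have : 0 < (1 - p.2) * (1 - a) by rewrite mulr_gt0//; have := a_le; lra.
move=> h3 h4.
by elim/forall_I4 => // _; rewrite !quadE /= /b; lra.
Qed.

Lemma map_region_c p : region_c p ->
  T p = (8 / 5 - 3 / 5 * p.1, 16 / 25 - 3 / 5 * p.2).
Proof.
move=> [h1 h2]; rewrite (@tangent_vertexE _ (Ordinal (erefl : 2 < 4)%N)).
  by rewrite quadE; congr pair => /=; rewrite /b; lra.
move: h2; rewrite /bc_form => h2.
have y1 : p.2 < 2 / 5.
  rewrite ltNge; apply/negP => y1.
  have : 0 <= (1 - a) * (p.2 - 2 / 5) by rewrite mulr_ge0//; have := a_le; lra.
  by lra.
have h3 : 0 < a * (2 / 5 - p.2) by rewrite mulr_gt0//; lra.
by elim/forall_I4 => // _; rewrite !quadE /= /b; lra.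
Qed.

Lemma map_region_d p : region_d p ->
  T p = (- (3 / 5) * p.1, - (3 / 5) * p.2).
Proof.
move=> [h1 h2]; rewrite (@tangent_vertexE _ (Ordinal (erefl : 3 < 4)%N)).
  by rewrite quadE; congr pair => /=; rewrite /b; lra.
have h3 : 0 < a * (p.2 - 2 / 5 * p.1) by rewrite mulr_gt0//; lra.
have h4 : 0 <= (- p.1) * (1 / 2 - a) by rewrite mulr_ge0//; have := a_le; lra.
by elim/forall_I4 => // _; rewrite !quadE /= /b; lra.
Qed.

End Quadrilateral.

(** * Entrance into the attracting strip and the return itineraries *)

Section QuadrilateralDynamics.
Variables (R : realType) (a : R).
Hypothesis a_range : 2 / 5 <= a <= 1 / 2.

Let a_ge : 2 / 5 <= a. Proof. by case/andP: a_range. Qed.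
Let a_le : a <= 1 / 2. Proof. by case/andP: a_range. Qed.
Let T := quad_map a (2 / 5).

Definition regular (p : R * R) := forall i, off_rays a (iter i T p).

Lemma regular_iter n p : regular p -> regular (iter n T p).
Proof. by move=> gp i; rewrite -iterD; exact: gp. Qed.

Lemma domain_regular p : quad_domain a (2 / 5) p -> regular p /\ region a p.
Proof.
move=> dom; have gp : regular p by move=> i Si; apply: dom; right; exists i.
split=> //; have [//|[x0 y1 dd f0]] := off_regionP a_range (gp 0%N).
by exfalso; apply: dom; left; exact: polygon_inside.
Qed.

Lemma regular_domain p : regular p -> p.1 < 0 -> quad_domain a (2 / 5) p.
Proof.
move=> gp x0 [Pp|[i _ Si]]; last exact: (gp i).
have := @polygon_halfplane R 4 (quad a (2 / 5)) 1 0 0 _ p Pp.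
rewrite mul1r mul0r !addr0 => H.
have : 0 <= p.1.
  by apply: H; elim/forall_I4; rewrite quadE /=; have := a_ge; lra.
by rewrite leNgt x0.
Qed.

(** The map is a contracted reflection in the tangent vertex, so P and the image
    are on opposite sides of a line through that vertex. *)
Lemma map_region p : region a p -> off_rays a (T p) -> region a (T p).
Proof.
move=> reg /(off_regionP a_range)[//|[]].
case: reg => -[h1 h2].
- by rewrite /T map_region_a//=; lra.
- by rewrite /T map_region_b//=; lra.
- move=> _ _ _; rewrite /T map_region_c// /bc_form /=.
  by move: h2; rewrite /bc_form; lra.
- by rewrite /T map_region_d//=; lra.
Qed.

Lemma orbit_region p n : regular p -> region a p -> region a (iter n T p).
Proof.
move=> gp reg; elim: n => // n IH; rewrite iterS; apply: map_region => //.
by rewrite -iterS; exact: gp.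
Qed.

Lemma region_c_low p : region_c a p -> p.2 < 2 / 5.
Proof.
move=> [h1]; rewrite /bc_form => h2; rewrite ltNge; apply/negP => y1.
have : 0 <= (1 - a) * (p.2 - 2 / 5) by rewrite mulr_ge0//; have := a_le; lra.
by lra.
Qed.

Lemma region_c_intro p : p.2 < 2 / 5 * p.1 -> p.1 < 1 -> region_c a p.
Proof.
move=> h1 h2; split=> //; rewrite /bc_form.
have : 0 <= (1 - a) * (2 / 5 - p.2) by rewrite mulr_ge0//; have := a_le; lra.
by lra.
Qed.

(** The interval [-3/2, 5/2] is invariant under the extreme cases, which are the
    maps x to -3/5 x and x to 8/5 - 3/5 x, and a margin around it contracts. *)
Lemma map_x_bound p m : region a p -> 0 <= m ->
  - (3 / 2) - m <= p.1 <= 5 / 2 + m ->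
  - (3 / 2) - 3 / 5 * m <= (T p).1 <= 5 / 2 + 3 / 5 * m.
Proof.
have := a_ge; have := a_le => a1 a0 [] reg m0 xm; rewrite /T.
- by rewrite map_region_a//=; lra.
- by rewrite map_region_b//=; lra.
- by rewrite map_region_c//=; lra.
- by rewrite map_region_d//=; lra.
Qed.

(** Once the abscissa is at least -8/5, region b is only entered from region c,
    where the ordinate is less than 2/5. *)
Lemma map_to_b p : region a p -> - (8 / 5) <= p.1 -> region_b a (T p) ->
  2 / 5 < (T p).2.
Proof.
have a1 : 0 < 1 - a by have := a_le; lra.
move=> [] reg x0; rewrite /T.
- rewrite map_region_a// /region_b /bc_form /=; case: reg => h1 h2 [h3 h4].
  have : 0 < (1 - a) * (1 - (8 / 5 - 3 / 5 * p.2)) by rewrite mulr_gt0//; lra.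
  by have := a_ge; lra.
- by rewrite map_region_b// /region_b /=; case: reg => h1 h2; lra.
- by have := region_c_low reg; rewrite map_region_c//=; lra.
- rewrite map_region_d// /region_b /bc_form /=; case: reg => h1 h2 [h3 h4].
  have : 0 < (1 - a) * (2 / 5 - (- (3 / 5) * p.2)) by rewrite mulr_gt0//; lra.
  by lra.
Qed.

(** Here 34/25 is 8/5 - 3/5 * 2/5, the supremum of the ordinates reached from
    region b when those of region b exceed 2/5, and 102/125 is 3/5 * 34/25. *)
Lemma map_y_bound p m : region a p -> (region_b a p -> 2 / 5 < p.2) -> 0 <= m ->
  - (102 / 125) - m <= p.2 <= 34 / 25 + m ->
  - (102 / 125) - 3 / 5 * m <= (T p).2 <= 34 / 25 + 3 / 5 * m.
Proof.
move=> [] reg yb m0 ym; rewrite /T.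
- by rewrite map_region_a//=; case: reg; lra.
- by have := yb reg; rewrite map_region_b//=; case: reg; lra.
- by have := region_c_low reg; rewrite map_region_c//=; lra.
- by rewrite map_region_d//=; lra.
Qed.

Lemma shrinking_margin (m : R) : 0 <= m ->
  exists N, forall n, (N <= n)%N -> (3 / 5) ^+ n * m <= 1 / 10.
Proof.
move=> m0; have [||N HN] := @lam_small R (3 / 5) _ m (1 / 10); [lra|lra|].
by exists N.
Qed.

(** The abscissa is within 1/10 of its limiting interval; coarser bounds suffice
    for the ordinate. *)
Definition settled (p : R * R) :=
  [/\ region a p, - (8 / 5) <= p.1 <= 13 / 5 & - 1 <= p.2 <= 13 / 5].

Lemma eventually_settled p : regular p -> region a p ->
  exists N, forall n, (N <= n)%N -> settled (iter n T p).
Proof.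
move=> gp reg; have regn n := orbit_region n gp reg.
have [m m0 xm] : exists2 m, 0 <= m & - (3 / 2) - m <= p.1 <= 5 / 2 + m.
  exists `|p.1|; first exact: normr_ge0.
  by have := ler_norm p.1; have := ler_norm (- p.1); rewrite normrN; lra.
have xn n : - (3 / 2) - (3 / 5) ^+ n * m <= (iter n T p).1 <=
    5 / 2 + (3 / 5) ^+ n * m.
  elim: n => [|n IH]; first by rewrite expr0 mul1r.
  rewrite exprS -mulrA iterS; apply: map_x_bound => //.
  by rewrite mulr_ge0// exprn_ge0.
have [N HN] := shrinking_margin m0.
have xN n : (N <= n)%N -> - (8 / 5) <= (iter n T p).1 <= 13 / 5.
  by move=> /HN; have := xn n; lra.
pose q := iter N.+1 T p.
have yb n : region_b a (iter n T q) -> 2 / 5 < (iter n T q).2.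
  rewrite /q -iterD addnS iterS; apply: map_to_b => //.
  by have /andP[] := xN (n + N)%N (leq_addl _ _).
have [k k0 yk] : exists2 m, 0 <= m &
    - (102 / 125) - m <= q.2 <= 34 / 25 + m.
  exists `|q.2|; first exact: normr_ge0.
  by have := ler_norm q.2; have := ler_norm (- q.2); rewrite normrN; lra.
have yn n : - (102 / 125) - (3 / 5) ^+ n * k <= (iter n T q).2 <=
    34 / 25 + (3 / 5) ^+ n * k.
  elim: n => [|n IH]; first by rewrite expr0 mul1r.
  rewrite exprS -mulrA iterS; apply: map_y_bound => //.
    by rewrite /q -iterD.
    exact: yb.
  by rewrite mulr_ge0// exprn_ge0.
have [K HK] := shrinking_margin k0.
exists (K + N.+1)%N => n Kn; split=> //.
  by apply: xN; apply: leq_trans Kn; rewrite addnS ltnW// ltnS leq_addl.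
have nE : n = (n - N.+1 + N.+1)%N by rewrite subnK// (leq_trans _ Kn)// leq_addl.
have := yn (n - N.+1)%N; rewrite /q -iterD -nE.
have Kn' : (K <= n - N.+1)%N by rewrite -(leq_add2r N.+1) -nE.
by have := HK _ Kn'; lra.
Qed.

(** In the limiting box, region a is mapped to region d, region b to a or d, and
    region c to a or b. *)
Lemma reaches_d p : regular p -> region a p ->
  exists n, settled (iter n T p) /\ region_d (iter n T p).
Proof.
move=> gp reg; have [N HN] := eventually_settled gp reg.
have a1 : 0 < 1 - a by have := a_le; lra.
have fromA n : (N <= n)%N -> region_a (iter n T p) -> region_d (iter n.+1 T p).
  move=> /HN[_ _ yn] ra; rewrite iterS /T map_region_a// /region_d /=.
  by case: ra => h1 h2; split; lra.
have fromB n : (N <= n)%N -> region_b a (iter n T p) ->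
    region_a (iter n.+1 T p) \/ region_d (iter n.+1 T p).
  move=> /HN[_ _ yn] rb.
  have y1 : 1 < (iter n.+1 T p).2.
    by rewrite iterS /T map_region_b//=; case: rb; lra.
  have := orbit_region n.+1 gp reg => -[]; [by left| | |by right].
    by case; lra.
  by case=> h1; rewrite /bc_form => h2; exfalso; have := region_c_low (conj h1 h2); lra.
have fromC n : (N <= n)%N -> region_c a (iter n T p) ->
    region_a (iter n.+1 T p) \/ region_b a (iter n.+1 T p).
  move=> /HN[_ xn _] rc.
  have := orbit_region n.+1 gp reg => -[]; [by left|by right| |].
    case=> _; rewrite iterS /T map_region_c// /bc_form /=.
    by case: rc => _; rewrite /bc_form; lra.
  by case; rewrite iterS /T map_region_c//=; lra.
suff [n Nn dn] : exists2 n, (N <= n)%N & region_d (iter n T p).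
  by exists n; split=> //; exact: HN.
have reachA n : (N <= n)%N -> region_a (iter n T p) ->
    exists2 n, (N <= n)%N & region_d (iter n T p).
  by move=> Nn /(fromA _ Nn); exists n.+1 => //; exact: leqW.
have reachB n : (N <= n)%N -> region_b a (iter n T p) ->
    exists2 n, (N <= n)%N & region_d (iter n T p).
  move=> Nn /(fromB _ Nn)[]; first by apply: reachA; exact: leqW.
  by exists n.+1 => //; exact: leqW.
have := orbit_region N gp reg => -[].
- exact: reachA.
- exact: reachB.
- by move=> /(fromC _ (leqnn N))[]; [apply: reachA|apply: reachB].
- by exists N.
Qed.

(** The section on which the returns are taken. *)
Definition low (p : R * R) :=
  [/\ - (8 / 5) <= p.1, p.1 < 0, 2 / 5 * p.1 < p.2 & p.2 < 1].

(** The abscissa for which the third iterate falls on the ray from (0, 0) through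
    (0, 1). *)
Definition break : R := 40 / 27 * (5 * a - 3).

Lemma break_range : - (40 / 27) <= break <= - (20 / 27).
Proof. by rewrite /break; have := a_ge; have := a_le; lra. Qed.

Lemma orbit_d p : - (8 / 5) <= p.1 -> region_d p ->
  [/\ region_c a (iter 1 T p),
    iter 1 T p = (- (3 / 5) * p.1, - (3 / 5) * p.2) &
    iter 2 T p = (8 / 5 + 9 / 25 * p.1, 16 / 25 + 9 / 25 * p.2)].
Proof.
move=> x1 rd.
have E1 : iter 1 T p = (- (3 / 5) * p.1, - (3 / 5) * p.2) by exact: map_region_d.
have rc : region_c a (iter 1 T p).
  by case: rd => x0 dd; rewrite E1; apply: region_c_intro => /=; lra.
split=> //; rewrite iterS {1}/T map_region_c// -/T E1.
by congr pair => /=; lra.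
Qed.

(** Above the line y = 1 the third vertex used is (0, 1), and so that the height
    y - 1 changes sign at the third step. *)
Lemma orbit_high p : - (8 / 5) <= p.1 -> p.1 < 0 -> 1 < p.2 ->
  iter 3 T p = (- (24 / 25) - 27 / 125 * p.1, 152 / 125 - 27 / 125 * p.2).
Proof.
move=> x1 x0 y1; have [||_ _ E2] := @orbit_d p; [by []|by split; lra|].
have ra : region_a (iter 2 T p) by rewrite E2; split=> /=; lra.
by rewrite iterS {1}/T map_region_a// -/T E2; congr pair => /=; lra.
Qed.

Lemma orbit_low p : low p ->
  (forall j, (j < 3)%N -> region a (iter j T p)) /\
  iter 3 T p = (- (27 / 125) * (p.1 - break), 152 / 125 - 27 / 125 * p.2).
Proof.
move=> [x1 x0 dd y1]; have a1 := a_le; have a0 := a_ge.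
have rd : region_d p by split.
have [rc E1 E2] := orbit_d x1 rd.
have rb : region_b a (iter 2 T p).
  rewrite E2; split; rewrite /bc_form /=; first by lra.
  have : 0 < (1 - a) * (16 / 25 + 9 / 25 * p.2 - 2 / 5) by rewrite mulr_gt0//; lra.
  by lra.
split.
  by move=> [|[|[|//]]] _; [constructor 4|constructor 3|constructor 2].
by rewrite iterS {1}/T map_region_b// -/T E2 /break; congr pair => /=; lra.
Qed.

(** Left of the break the vertices used are (0, 0), (1, 2/5), (a, 1), (0, 1). *)
Lemma orbit_low_left p : low p -> p.1 < break ->
  (forall j, (j < 4)%N -> region a (iter j T p)) /\
  iter 4 T p = (81 / 625 * (p.1 - break), 544 / 625 + 81 / 625 * p.2).
Proof.
move=> lp xc; have [reg E3] := orbit_low lp; case: lp => x1 x0 dd y1.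
have ra : region_a (iter 3 T p) by rewrite E3; split=> /=; lra.
split=> [j|].
  by rewrite ltnS leq_eqVlt => /orP[/eqP->|/reg//]; constructor 1.
by rewrite iterS /T map_region_a// -/T E3; congr pair => /=; lra.
Qed.

(** Right of the break the orbit comes back to region d above the line y = 1,
    and goes around once more, now through (0, 1) instead of (a, 1). *)
Lemma orbit_low_right p : low p -> break < p.1 ->
  [/\ forall j, (j < 6)%N -> region a (iter j T p),
    iter 4 T p = (81 / 625 * (p.1 - break), - (456 / 625) + 81 / 625 * p.2),
    iter 5 T p = (8 / 5 - 243 / 3125 * (p.1 - break),
                  3368 / 3125 - 243 / 3125 * p.2) &
    iter 6 T p = (- (24 / 25) + 729 / 15625 * (p.1 - break),
                  14896 / 15625 + 729 / 15625 * p.2)].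
Proof.
move=> lp xc; have [reg E3] := orbit_low lp; case: lp => x1 x0 dd y1.
have a1 := a_le; have a0 := a_ge; have /andP[c0 c1] := break_range.
have rd : region_d (iter 3 T p) by rewrite E3; split=> /=; lra.
have E4 : iter 4 T p = (81 / 625 * (p.1 - break), - (456 / 625) + 81 / 625 * p.2).
  by rewrite iterS /T map_region_d// -/T E3 {rd reg E3}; congr pair => /=; lra.
have rc : region_c a (iter 4 T p).
  by rewrite E4 {rd reg E3 E4}; apply: region_c_intro => /=; lra.
have E5 : iter 5 T p = (8 / 5 - 243 / 3125 * (p.1 - break),
                  3368 / 3125 - 243 / 3125 * p.2).
  rewrite iterS /T map_region_c// -/T E4 {rd rc reg E3 E4}.
  by congr pair => /=; lra.
have ra : region_a (iter 5 T p).
  by rewrite E5 {rd rc reg E3 E4 E5}; split=> /=; lra.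
split=> //; last first.
  rewrite iterS /T map_region_a// -/T E5 {rd rc ra reg E3 E4 E5}.
  by congr pair => /=; lra.
move=> j; rewrite ltnS leq_eqVlt => /orP[/eqP->|]; first by constructor 1.
rewrite ltnS leq_eqVlt => /orP[/eqP->|]; first by constructor 3.
rewrite ltnS leq_eqVlt => /orP[/eqP->|/reg//]; by constructor 4.
Qed.

End QuadrilateralDynamics.

(** * All omega-limit sets of the domain coincide *)

Section QuadrilateralAttractor.
Variables (R : realType) (a : R).
Hypothesis a_range : 2 / 5 <= a <= 1 / 2.

Let T : R * R -> R * R := quad_map a (2 / 5).
Let c : R := break a.
Let c_range : - (40 / 27) <= c <= - (20 / 27) := break_range a_range.

(** The orbits of the domain avoid the line y = 1 left of P, but they are
    attracted by it; the sets below are its one-sided neighbourhoods. *)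
Definition near_line (eta : R) : set (R * R) :=
  [set p | [/\ regular a p, low p & 1 - eta < p.2]].

Let lam4 : (3 / 5) ^+ 4 = 81 / 625 :> R.
Proof. by rewrite !exprS expr0; lra. Qed.
Let lam6 : (3 / 5) ^+ 6 = 729 / 15625 :> R.
Proof. by rewrite !exprS expr0; lra. Qed.
Let lam01 : 0 < (3 / 5 : R) < 1. Proof. by lra. Qed.

(** The third iterate of a point of abscissa c falls on a forbidden ray. *)
Lemma near_line_avoid eta p : near_line eta p -> p.1 != c.
Proof.
move=> [gp lp _]; apply/eqP => pc; have [_ E3] := orbit_low a_range lp.
apply: (gp 3%N); apply/side_raysP => //; constructor 4.
move: E3; rewrite -/T; case: (iter 3 T p) => u v [-> ->] /=; rewrite -/c pc subrr mulr0; split=> //.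
by case: lp {gp} => x1 x0 dd y1; lra.
Qed.

Lemma near_line_left eta p : near_line eta p -> p.1 < c ->
  near_line (81 / 625 * eta) (iter 4 T p) /\
  (iter 4 T p).1 = (3 / 5) ^+ 4 * (p.1 - c).
Proof.
move=> [gp lp pe] pc; have [_] := orbit_low_left a_range lp pc.
have g4 : regular a (iter 4 T p) by exact: regular_iter.
rewrite lam4 -/T; have c1 := c_range.
rewrite /near_line /low; case: (iter 4 T p) g4 => x y /[swap] -[-> ->] g4 /=.
case: lp => x1 x0 dd y1; split; last by [].
split; [exact: g4| |by clear gp g4; lra].
by clear gp g4; split; rewrite -/c; lra.
Qed.

Lemma near_line_right eta p : near_line eta p -> c < p.1 ->
  near_line (81 / 625 * eta) (iter 6 T p) /\
  (iter 6 T p).1 = - (24 / 25) + (3 / 5) ^+ 6 * (p.1 - c).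
Proof.
move=> [gp lp pe] pc; have [_ _ _] := orbit_low_right a_range lp pc.
have g6 : regular a (iter 6 T p) by exact: regular_iter.
rewrite lam6 -/T; have c1 := c_range.
rewrite /near_line /low; case: (iter 6 T p) g6 => x y /[swap] -[-> ->] g6 /=.
case: lp => x1 x0 dd y1; split; last by [].
split; [exact: g6| |by clear gp g6; lra].
by clear gp g6; split; rewrite -/c; lra.
Qed.

Lemma near_line_mono eta eta' : eta <= eta' -> near_line eta `<=` near_line eta'.
Proof. by move=> le p [gp lp pe]; split=> //; lra. Qed.

Lemma near_line_return eta p : near_line eta p -> exists n,
  [/\ near_line (81 / 625 * eta) (iter n.+1 T p) &
      - (24 / 25) < (iter n.+1 T p).1 < 0].
Proof.
move=> np; have := near_line_avoid np; have c1 := c_range.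
have [_ [x1 x0 _ _] _] := np.
rewrite neq_lt => /orP[pc|pc].
  by exists 3%N; have [? ->] := near_line_left np pc; rewrite lam4; split=> //; lra.
by exists 5%N; have [? ->] := near_line_right np pc; rewrite lam6; split=> //; lra.
Qed.

(** Region d is reached with y < 1, at once or three steps later; the case y = 1
    is excluded because the second iterate would be on the ray from (0, 1)
    through (a, 1).  Then 1 - y decreases by a factor at least 81/625 at each
    return. *)
Lemma near_line_reached eta p : regular a p -> region a p -> 0 < eta ->
  exists n, near_line eta (iter n T p).
Proof.
move=> gp reg eta0.
have [n [[_ xn yn] dn]] := reaches_d a_range gp reg.
have gn : regular a (iter n T p) by exact: regular_iter.
rewrite -/T in xn yn dn; set q := iter n T p in gn xn yn dn.
have x1 : - (8 / 5) <= q.1 by lra.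
have [x0 dd] := dn.
have [i near2] : exists i, near_line 2 (iter i T q).
  have [y1|y1|y1] := ltrgtP q.2 1.
  - by exists 0%N; split=> //; lra.
  - exists 3%N; have E := orbit_high a_range x1 x0 y1.
    by split; [exact: regular_iter| |]; rewrite E ?/low /=; last lra; split=> /=; lra.
  - exfalso; have [_ _ E2] := orbit_d a_range x1 dn.
    apply: (gn 2%N); apply/side_raysP => //; constructor 1.
    by rewrite E2 /=; split; lra.
have [||k ke] := @geometric_lt R (81 / 625) (eta / 2); [lra|lra|].
have [j nj] : exists j, near_line ((81 / 625) ^+ k * 2) (iter j T q).
  elim: k {ke} => [|k [j nj]]; first by exists i; rewrite expr0 mul1r.
  have [l [nl _]] := near_line_return nj.
  by exists (l.+1 + j)%N; rewrite exprS -mulrA iterD.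
exists (j + n)%N; rewrite iterD; apply: near_line_mono nj; lra.
Qed.

Lemma near_line_dist eta p q : near_line eta p -> near_line eta q ->
  `|p - q| <= `|p.1 - q.1| + eta.
Proof.
move=> [_ [_ _ _ p1] pe] [_ [_ _ _ q1] qe].
rewrite prod_normE /= ge_max lerDl; apply/andP; split; first by lra.
by have h := normr_ge0 (p.1 - q.1); rewrite ler_norml; lra.
Qed.

Lemma near_line_diam eta p q : near_line eta p -> near_line eta q ->
  `|p - q| <= 8 / 5 + eta.
Proof.
move=> np nq; apply: le_trans (near_line_dist np nq) _.
case: np => _ [? ? _ _] _; case: nq => _ [? ? _ _] _.
by rewrite lerD2r ler_norml; lra.
Qed.

Let pairwise (j : nat) (u v p q : R * R) (k : R) : (- (3 / 5)) ^+ j = k ->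
  u.1 - v.1 = k * (p.1 - q.1) -> u.2 - v.2 = k * (p.2 - q.2) ->
  u - v = (- (3 / 5)) ^+ j *: (p - q).
Proof.
by move=> ->; case: u v p q => [? ?] [? ?] [? ?] [? ?] /= h1 h2; congr pair.
Qed.

Let powers : [/\ (- (3 / 5)) ^+ 1 = - (3 / 5) :> R, (- (3 / 5)) ^+ 2 = 9 / 25 :> R,
  (- (3 / 5)) ^+ 3 = - (27 / 125) :> R, (- (3 / 5)) ^+ 4 = 81 / 625 :> R &
  (- (3 / 5)) ^+ 5 = - (243 / 3125) :> R /\ (- (3 / 5)) ^+ 6 = 729 / 15625 :> R].
Proof. by rewrite !exprS expr0; do ?split; lra. Qed.

Let pairwise_iter j p q k (E F : R * R) : (- (3 / 5)) ^+ j = k ->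
  iter j T p = E -> iter j T q = F ->
  E.1 - F.1 = k * (p.1 - q.1) -> E.2 - F.2 = k * (p.2 - q.2) ->
  iter j T p - iter j T q = (- (3 / 5)) ^+ j *: (p - q).
Proof. by move=> kE -> ->; exact: pairwise. Qed.

Let coupled3 p q : low p -> low q ->
  forall j, (j <= 3)%N -> iter j T p - iter j T q = (- (3 / 5)) ^+ j *: (p - q).
Proof.
move=> lp lq; have [p1 p2 p3 _ _] := powers.
have [_ E3] := orbit_low a_range lp; have [_ F3] := orbit_low a_range lq.
have [xp dp] : - (8 / 5) <= p.1 /\ region_d p by case: lp.
have [_ E1 E2] := orbit_d a_range xp dp.
have [xq dq] : - (8 / 5) <= q.1 /\ region_d q by case: lq.
have [_ F1 F2] := orbit_d a_range xq dq.
move=> [|[|[|[|//]]]] _; first by rewrite expr0 scale1r.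
- by apply: (pairwise_iter p1 E1 F1) => {E1 E2 E3 F1 F2 F3 p1 p2 p3} /=; lra.
- by apply: (pairwise_iter p2 E2 F2) => {E1 E2 E3 F1 F2 F3 p1 p2 p3} /=; lra.
- by apply: (pairwise_iter p3 E3 F3) => {E1 E2 E3 F1 F2 F3 p1 p2 p3} /=; lra.
Qed.

Lemma near_line_left_coupled eta p q : near_line eta p -> near_line eta q ->
  p.1 < c -> q.1 < c -> coupled T (3 / 5) 4 p q.
Proof.
move=> [_ lp _] [_ lq _] pc qc j; have [_ _ _ p4 _] := powers.
have [_ E4] := orbit_low_left a_range lp pc.
have [_ F4] := orbit_low_left a_range lq qc.
rewrite leq_eqVlt => /orP[/eqP->|/(coupled3 lp lq)//].
by apply: (pairwise_iter p4 E4 F4) => {E4 F4 p4} /=; lra.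
Qed.

Lemma near_line_right_coupled eta p q : near_line eta p -> near_line eta q ->
  c < p.1 -> c < q.1 -> coupled T (3 / 5) 6 p q.
Proof.
move=> [_ lp _] [_ lq _] pc qc j; have [_ _ _ p4 [p5 p6]] := powers.
have [_ E4 E5 E6] := orbit_low_right a_range lp pc.
have [_ F4 F5 F6] := orbit_low_right a_range lq qc.
rewrite leq_eqVlt => /orP[/eqP->|].
  by apply: (pairwise_iter p6 E6 F6) => {E4 E5 E6 F4 F5 F6 p4 p5 p6} /=; lra.
rewrite ltnS leq_eqVlt => /orP[/eqP->|].
  by apply: (pairwise_iter p5 E5 F5) => {E4 E5 E6 F4 F5 F6 p4 p5 p6} /=; lra.
rewrite ltnS leq_eqVlt => /orP[/eqP->|/(coupled3 lp lq)//].
by apply: (pairwise_iter p4 E4 F4) => {E4 E5 E6 F4 F5 F6 p4 p5 p6} /=; lra.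
Qed.

(** The initial step of the renormalisation: the left branch has limit 0 at the
    break, and the right branch has limit -24/25. *)
Lemma near_line_renorm eta : 0 < eta -> - (24 / 25) < c ->
  renorm T (3 / 5) fst c (near_line eta) (- (24 / 25)) 0 4 6.
Proof.
move=> eta0 c0; have c1 := c_range.
have le : 81 / 625 * eta <= eta by lra.
split=> //.
- exact: near_line_avoid.
- lra.
- move=> p np /andP[_ pc]; have [np' ->] := near_line_left np pc.
  by rewrite add0r; split=> //; exact: near_line_mono np'.
- move=> p np /andP[pc _]; have [np' ->] := near_line_right np pc.
  by split=> //; exact: near_line_mono np'.
- by move=> p q np nq /andP[_ pc] /andP[_ qc]; exact: near_line_left_coupled nq pc qc.
- by move=> p q np nq /andP[pc _] /andP[qc _]; exact: near_line_right_coupled nq pc qc.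
- move=> p /near_line_return[n [np pn]]; exists n.+1; split=> //.
  exact: near_line_mono np.
Qed.

(** If the break is not inside (-24/25, 0), every orbit ends up on its right. *)
Lemma near_line_locked eta : 0 < eta -> c <= - (24 / 25) ->
  phase_locked T (3 / 5) (near_line eta).
Proof.
move=> eta0 c0; have le : 81 / 625 * eta <= eta by lra.
pose W := [set p | near_line eta p /\ - (24 / 25) < p.1].
have WW p : W p -> W (iter 6 T p).
  move=> [np pc]; have cp : c < p.1 by lra.
  have [np' E] := near_line_right np cp; split; first exact: near_line_mono np'.
  by rewrite E lam6; lra.
have Wk p k : W p -> W (iter (k * 6) T p).
  by move=> Wp; elim: k => // k IH; rewrite mulSn iterD; exact: WW.
exists W; split.
- by move=> p [].
- move=> p /near_line_return[n [np /andP[pn _]]] M.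
  exists (M * 6 + n.+1)%N.
    by apply: leq_trans (leq_addr _ _); rewrite leq_pmulr.
  by rewrite iterD; apply: Wk; split=> //; exact: near_line_mono np.
- move=> p q Wp Wq k.
  have : coupled T (3 / 5) (k * 6) p q.
    elim: k => [|k IH].
      by move=> j; rewrite mul0n leqn0 => /eqP->; rewrite expr0 scale1r.
    rewrite mulSn; apply: coupled_cat => //.
    have [np pc] := Wk _ k Wp; have [nq qc] := Wk _ k Wq.
    by apply: (near_line_right_coupled np nq); lra.
  by move=> H j jk; apply: H; apply: leq_trans jk _; rewrite leq_pmulr.
Qed.

(** Renormalise until the interval is shorter than eps / 2, or until the orbits
    are locked. *)
Lemma regular_shadows p q eps : regular a p -> region a p -> regular a q -> region a q ->
  0 < eps -> shadows T eps p q.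
Proof.
move=> gp rp gq rq e0; have e20 : 0 < eps / 2 by lra.
have [i ni] := near_line_reached gp rp e20.
have [j nj] := near_line_reached gq rq e20.
apply: (@shadows_iter _ _ _ _ i j).
have by_lock : phase_locked T (3 / 5) (near_line (eps / 2)) ->
    shadows T eps (iter i T p) (iter j T q).
  move=> lock; apply: (phase_locked_shadows lam01 lock) ni nj => //.
  exact: near_line_diam.
have [cp|cp] := leP c (- (24 / 25)).
  by apply: by_lock; exact: near_line_locked.
have [|k ke] := @geometric_lt R (3 / 5) (eps / 2) _ e20; first lra.
have := renorm_shrink lam01 k (near_line_renorm e20 cp).
case=> [//|[p' [q' [m' [n' [rn le]]]]]].
have [N HN] := renorm_shadows lam01 rn (@near_line_dist _) ni nj.
exists N => n Nn M; have [l Ml nl] := HN n Nn M; exists l => //.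
by apply: le_trans nl _; lra.
Qed.

Lemma domain_omega_limit p q : quad_domain a (2 / 5) p ->
  quad_domain a (2 / 5) q -> omega_limit T p = omega_limit T q.
Proof.
move=> /(domain_regular a_range)[gp rp] /(domain_regular a_range)[gq rq].
by apply/seteqP; split; apply: shadows_omega_sub => eps e0; exact: regular_shadows.
Qed.

End QuadrilateralAttractor.

(** * The attractor, and when it is a Cantor set *)

Section Nonempty.
Variables (R : realType) (a : R).
Hypothesis a_range : 2 / 5 <= a <= 1 / 2.

Let T : R * R -> R * R := quad_map a (2 / 5).
Let c : R := break a.
Let c_range : - (40 / 27) <= c <= - (20 / 27) := break_range a_range.

(** The first return map to the section acts on abscissas by itself. *)
Definition return_map (x : R) : R :=
  if x < c then 81 / 625 * (x - c) else - (24 / 25) + 729 / 15625 * (x - c).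

(** During an excursion all points lie in the open regions, so the only way to
    hit a ray is to start it at the break. *)
Lemma low_regular p : low p -> (forall k, iter k return_map p.1 != c) -> regular a p.
Proof.
move=> lp gp n; have [m nm] := ubnP n.
elim: m n p lp gp nm => // m IH n p lp gp nm.
have next k : low (iter k T p) -> (0 < k)%N ->
    (iter k T p).1 = return_map p.1 ->
    (forall j, (j < k)%N -> region a (iter j T p)) -> off_rays a (iter n T p).
  move=> lk k0 xk regk; have [nk|kn] := ltnP n k.
    by apply: region_off => //; exact: regk.
  rewrite -(subnK kn) iterD; apply: IH => //.
    by move=> j; rewrite xk -iterSr; exact: gp.
  by rewrite ltnS in nm; apply: leq_trans nm; rewrite ltn_subrL k0 (leq_trans k0 kn).
have := gp 0%N; rewrite /= neq_lt => /orP[pc|pc].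
  have [reg4 E4] := orbit_low_left a_range lp pc.
  apply: (next 4%N) => //; rewrite /T E4 /=; last by rewrite /return_map pc.
  by case: lp {gp IH next reg4 E4} => x1 x0 dd y1; split=> /=; rewrite -/c; have := c_range; lra.
have [reg6 _ _ E6] := orbit_low_right a_range lp pc.
apply: (next 6%N) => //; rewrite /T E6 /=.
  by case: lp {gp IH next reg6 E6} => x1 x0 dd y1; split=> /=; rewrite -/c; have := c_range; lra.
by rewrite /return_map ltNge ltW.
Qed.

Let bad k : set R := [set x | iter k return_map x = c].

Let bad_countable k : countable (bad k).
Proof.
elim: k => [|k IH].
  apply: (@sub_countable _ _ _ [set c]); last exact: countable1.
  by apply: subset_card_le => x.
pose inv (b : bool) (y : R) : R :=
  if b then 625 / 81 * y + c else 15625 / 729 * (y + 24 / 25) + c.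
apply: (@sub_countable _ _ _ (\bigcup_(b in [set: bool]) (inv b @` bad k))).
  apply: subset_card_le => x; rewrite /bad /= -iterS iterSr => bx.
  exists (x < c) => //; exists (return_map x) => //.
  by rewrite /inv /return_map; case: (x < c) {bx}; lra.
apply: bigcup_countable => // b _.
exact: sub_countable (card_image_le _ _) IH.
Qed.

(** The abscissas to avoid are the iterated preimages of the break; each branch
    is injective, so they are countable. *)
Lemma start_avoiding_break (u v : R) : u < v -> exists2 x, u < x < v &
  forall k, iter k return_map x != c.
Proof.
move=> uv; apply: contrapT => none.
have cB : countable (\bigcup_k bad k) by apply: bigcup_countable.
have sub : (`]u, v[%classic : set R) `<=` \bigcup_k bad k.
  move=> x; rewrite /= in_itv /= => uxv; apply: contrapT => nb; apply: none.
  by exists x => // k; apply/eqP => bk; apply: nb; exists k.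
have : countable (`]u, v[%classic : set R).
  by apply: sub_countable cB; exact: subset_card_le.
move=> /countable_lebesgue_measure0; rewrite lebesgue_measure_itv /= lte_fin uv.
by move=> -[] /eqP; rewrite subr_eq0 gt_eqF.
Qed.

(** A point of the lower rectangle with abscissa in (-1/2, 0), an interval that
    the rectangle covers because l is at least 5/3. *)
Lemma domain_meets_rect eps : 0 < eps < 1 ->
  (quad_domain a (2 / 5) `&`
   (upper_rect a (2 / 5) eps `|` lower_rect a (2 / 5) eps)) !=set0.
Proof.
move=> eps01; have [|x xu xk] := @start_avoiding_break (- (1 / 2)) 0; first by lra.
pose d := eps ^+ 2 / 2.
have e2 : 0 < eps ^+ 2 by rewrite exprn_gt0//; lra.
have e21 : eps ^+ 2 < 1 by rewrite expr2; nra.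
have lp : low (x, 1 - d) by split=> /=; rewrite /d; lra.
exists (x, 1 - d); split; first by apply: regular_domain => //=; [exact: low_regular|lra].
right; split; rewrite /= in_itv /=; last by rewrite /d; lra.
have -> : (1 - 2 / 5)^-1 = 5 / 3 :> R by field.
have := a_range; rewrite expr2; lra.
Qed.

(** The rectangles determine the attractor because they meet the domain. *)
Lemma attractorE p : quad_domain a (2 / 5) p ->
  attractor a (2 / 5) = omega_limit T p.
Proof.
move=> dp.
have pK : is_rect_attractor a (2 / 5) (omega_limit T p).
  exists 1 => // eps /domain_meets_rect ne D; split=> // q [dq _].
  exact: domain_omega_limit.
have [e0 e00 H] := getI pK; rewrite -/(attractor a (2 / 5)) in H.
have [e e0e1 ee0] : exists2 e, 0 < e < 1 & 0 < e < e0.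
  have m0 : 0 < Num.min e0 1 by rewrite lt_min e00 ltr01.
  have m1 : Num.min e0 1 <= e0 by rewrite ge_min lexx.
  have m2 : Num.min e0 1 <= 1 by rewrite ge_min lexx orbT.
  by exists (Num.min e0 1 / 2); lra.
have [_ {}H] := H _ ee0.
have [q [dq rq]] := domain_meets_rect e0e1.
rewrite -(H q); last by split.
exact: domain_omega_limit.
Qed.

Lemma domain_nonempty : quad_domain a (2 / 5) !=set0.
Proof.
have [|p [dp _]] := @domain_meets_rect (1 / 2); first by lra.
by exists p.
Qed.

Lemma omega_limit_compact p : quad_domain a (2 / 5) p ->
  compact (omega_limit T p) /\ omega_limit T p !=set0.
Proof.
move=> /(domain_regular a_range)[gp rp].
have [N HN] := eventually_settled a_range gp rp.
pose B : set (R * R) := `[- (8 / 5), 13 / 5]%classic `*` `[- 1, 13 / 5]%classic.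
have cB : compact B by apply: compact_setX; exact: segment_compact.
have BN k : (N <= k)%N -> B (iter k T p).
  by move=> /HN[_ xk yk]; split; rewrite /= in_itv.
split.
  apply: (subclosed_compact _ cB); first exact: omega_limit_closed.
  apply: (@omega_limit_sub_closed _ _ _ _ _ N) BN.
  by apply: compact_closed cB; exact: norm_hausdorff.
have [|x [_ ox]] := cB ((fun k => iter k T p) @ \oo) _; last by exists x.
by exists N.
Qed.

Lemma attractor_cantor p : quad_domain a (2 / 5) p ->
  infinitely_renormalizable T (3 / 5) fst c (fun r => (r, 1)) (@near_line R a) p ->
  is_cantor_set R (attractor a (2 / 5)).
Proof.
move=> dp ir; rewrite (attractorE dp) /is_cantor_set.
have lam01 : 0 < (3 / 5 : R) < 1 by lra.
apply: cantor_criterion_homeomorphic; first exact: middle_thirds_cantor.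
apply: (@cantor_criterion R (R * R)%type).
- exact: norm_hausdorff.
- exact: (omega_limit_compact dp).2.
- exact: (omega_limit_compact dp).1.
- move=> x U ox /nbhs_ballP[e /= e0 eU].
  have [y [oy yx xy]] := infinitely_renormalizable_perfect lam01 ir ox e0.
  by exists y; split=> //; apply: eU; rewrite -ball_normE.
- (* A gap in the projection by f separates the two points. *)
have split_by (f : R * R -> R) : continuous f ->
      (forall x y, `|f x - f y| <= `|x - y|) ->
      forall x y, omega_limit T p x -> omega_limit T p y -> f x != f y ->
      exists U V : set (R * R), [/\ open U, open V, U x /\ V y,
        omega_limit T p `<=` U `|` V &
        forall w, omega_limit T p w -> U w -> V w -> False].
    move=> cf f1 x y ox oy.
    wlog lt_xy : x y ox oy / f x < f y.
      move=> H fxy; have := fxy; rewrite neq_lt => /orP[|yx]; first by move=> ?; exact: H.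
      have [|U [V [oU oV [Uy Vx] KUV UV]]] := H y x oy ox yx; first by rewrite eq_sym.
      exists V, U; split=> //; first by rewrite setUC.
      by move=> w Kw Vw Uw; exact: (UV w).
    move=> _; have [t xty Kt] := infinitely_renormalizable_gap lam01 ir f1 lt_xy.
    exists (f @^-1` [set w | w < t]), (f @^-1` [set w | t < w]); split.
    + by apply: open_comp => //; exact: open_lt.
    + by apply: open_comp => //; exact: open_gt.
    + by rewrite /=; lra.
    + move=> w /Kt; rewrite neq_lt => /orP[]; [by left|by right].
    + by move=> w _ /=; lra.
  move=> x y ox oy xy.
  have norm1 (w : R * R) : `|w.1| <= `|w| by rewrite prod_normE le_max lexx.
  have norm2 (w : R * R) : `|w.2| <= `|w| by rewrite prod_normE le_max lexx orbT.
  have [x1|x1] := eqVneq x.1 y.1; last first.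
    apply: (split_by fst) => // [w|w w']; [exact: cvg_fst|exact: norm1 (w - w')].
  have [x2|x2] := eqVneq x.2 y.2; last first.
    apply: (split_by snd) => // [w|w w']; [exact: cvg_snd|exact: norm2 (w - w')].
  by case: x y x1 x2 xy {ox oy} => [? ?] [? ?] /= -> ->; rewrite eqxx.
Qed.

End Nonempty.

(** * A parameter that is renormalisable forever *)

Section CantorParameter.
Variable R : realType.

(** A renormalisation stage for an unknown break c: the ends of the interval are
    affine functions of c, and (u, v) stands for u + v c. *)
Record stage := Stage {
  left_end : R * R;
  right_end : R * R;
  left_time : nat;
  right_time : nat }.

Definition affine_at (f : R * R) (c : R) := f.1 + f.2 * c.
Definition fixed_point (f : R * R) := f.1 / (1 - f.2).

Definition next_right (st : stage) : R * R :=
  let u := (3 / 5) ^+ right_time st in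
  ((left_end st).1 + u * (right_end st).1,
   (left_end st).2 + u * ((right_end st).2 - 1)).

Definition next_left (st : stage) : R * R :=
  let v := (3 / 5) ^+ (right_time st + left_time st) in
  ((next_right st).1 + v * (left_end st).1,
   (next_right st).2 + v * ((left_end st).2 - 1)).

(** Both kinds of inducing in turn, first on the right and then on the left, so
    that both ends of the interval of possible breaks move at each stage. *)
Definition next_stage (st : stage) : stage :=
  Stage (next_left st) (next_right st) (right_time st + left_time st)
    (right_time st + left_time st + right_time st).

Definition stages (k : nat) : stage :=
  iter k next_stage (Stage (- (24 / 25), 0) (0, 0) 4 6).

Lemma affine_lt f c : f.2 <= 0 -> (affine_at f c < c) = (fixed_point f < c).
Proof.
move=> f0; have l0 : 0 < 1 - f.2 by lra.
by rewrite /fixed_point /affine_at ltr_pdivrMr//; apply/idP/idP; lra.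
Qed.

Lemma affine_gt f c : f.2 <= 0 -> (c < affine_at f c) = (c < fixed_point f).
Proof.
move=> f0; have l0 : 0 < 1 - f.2 by lra.
by rewrite /fixed_point /affine_at ltr_pdivlMr//; apply/idP/idP; lra.
Qed.

Lemma affine_fixed f : f.2 <= 0 -> affine_at f (fixed_point f) = fixed_point f.
Proof.
move=> f0; apply/eqP; rewrite eq_le !leNgt affine_lt// affine_gt//.
by rewrite ltxx.
Qed.

Lemma next_rightE st c : affine_at (next_right st) c =
  affine_at (left_end st) c +
  (3 / 5) ^+ right_time st * (affine_at (right_end st) c - c).
Proof. by rewrite /affine_at /next_right /=; ring. Qed.

Lemma next_leftE st c : affine_at (next_left st) c =
  affine_at (next_right st) c +
  (3 / 5) ^+ (right_time st + left_time st) * (affine_at (left_end st) c - c).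
Proof. by rewrite /affine_at /next_left /=; ring. Qed.

(** The ends decrease when c increases, so the stage is possible exactly for c
    between the two fixed points. *)
Definition admissible (st : stage) := [/\ (left_end st).2 <= 0,
  (right_end st).2 <= 0 & fixed_point (left_end st) < fixed_point (right_end st)].

(** At the fixed point of an end the break sits at that end, so the sign of the
    new end minus c at the old fixed points locates the new fixed points. *)
Lemma admissible_next st : admissible st -> [/\ admissible (next_stage st),
  fixed_point (left_end st) < fixed_point (left_end (next_stage st)) &
  fixed_point (right_end (next_stage st)) < fixed_point (right_end st)].
Proof.
move=> [l0 r0 lr].
have u0 : 0 < (3 / 5) ^+ right_time st :> R by rewrite exprn_gt0//; lra.
have v0 : 0 < (3 / 5) ^+ (right_time st + left_time st) :> R.
  by rewrite exprn_gt0//; lra.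
have nr0 : (next_right st).2 <= 0 by rewrite /next_right /=; nra.
have nl0 : (next_left st).2 <= 0 by rewrite /next_left /=; nra.
have l_nr : fixed_point (left_end st) < fixed_point (next_right st).
  rewrite -affine_gt// next_rightE affine_fixed// ltrDl mulr_gt0//.
  by rewrite subr_gt0 affine_gt.
have nr_r : fixed_point (next_right st) < fixed_point (right_end st).
  by rewrite -affine_lt// next_rightE affine_fixed// subrr mulr0 addr0 affine_lt.
have l_nl : fixed_point (left_end st) < fixed_point (next_left st).
  rewrite -affine_gt// next_leftE [affine_at (left_end st) _]affine_fixed//.
  by rewrite subrr mulr0 addr0 affine_gt.
have nl_nr : fixed_point (next_left st) < fixed_point (next_right st).
  rewrite -affine_lt// next_leftE affine_fixed// gtrDl pmulr_rlt0//.
  by rewrite subr_lt0 affine_lt.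
by split.
Qed.

Lemma stages_admissible k : admissible (stages k).
Proof.
elim: k => [|k IH]; last by case: (admissible_next IH).
by split; rewrite /fixed_point /= ?subr0 ?divr1; lra.
Qed.

(** The left fixed points increase strictly and stay below all right ones, which
    decrease strictly; their supremum is strictly between them. *)
Lemma exists_break : exists c : R, forall k,
  affine_at (left_end (stages k)) c < c < affine_at (right_end (stages k)) c.
Proof.
pose s k := fixed_point (left_end (stages k)).
pose t k := fixed_point (right_end (stages k)).
have sS k : s k < s k.+1 by case: (admissible_next (stages_admissible k)).
have tS k : t k.+1 < t k by case: (admissible_next (stages_admissible k)).
have st k : s k < t k by case: (stages_admissible k).
have s_mono i j : s i <= s (j + i)%N.
  by elim: j => // j IH; apply: le_trans IH _; rewrite addSn; exact/ltW/sS.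
have t_mono i j : t (j + i)%N <= t i.
  by elim: j => // j IH; apply: le_trans IH; rewrite addSn; exact/ltW/tS.
have s_lt_t i j : s i < t j.
  apply: le_lt_trans (s_mono i j) _; apply: lt_le_trans (t_mono j i).
  by rewrite addnC.
pose S := [set s k | k in [set: nat]].
have S0 : S !=set0 by exists (s 0%N); exists 0%N.
have Sub : has_ubound S by exists (t 0%N) => _ [k _ <-]; exact: ltW.
exists (sup S) => k; have [l0 r0 _] := stages_admissible k.
rewrite affine_lt// affine_gt//; apply/andP; split.
  apply: lt_le_trans (sS k) _; apply: ub_le_sup => //; by exists k.+1.
apply: le_lt_trans (tS k); apply: ge_sup => // _ [j _ <-]; exact: ltW.
Qed.

(** The parameter a is read off the break.  The first inducing step forces
    c < -20/27, that is, a < 1/2. *)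
Lemma cantor_parameter : exists a : R, 2 / 5 <= a <= 1 / 2 /\
  is_cantor_set R (attractor a (2 / 5)).
Proof.
have [c cP] := exists_break.
pose a : R := (27 / 40 * c + 3) / 5.
have ca : break a = c by rewrite /break /a; field.
have pow6 : (3 / 5) ^+ 6 = 729 / 15625 :> R by rewrite !exprS expr0; lra.
have a_range : 2 / 5 <= a <= 1 / 2.
  have := cP 0%N; have /andP[_] := cP 1%N.
  rewrite /stages /= /affine_at /= pow6 /a; lra.
exists a; split=> //.
have [p dp] := domain_nonempty a_range.
apply: (attractor_cantor a_range dp).
have [gp rp] := domain_regular a_range dp.
have lam01 : 0 < (3 / 5 : R) < 1 by lra.
have renorm_stages k eta : 0 < eta ->
    renorm (quad_map a (2 / 5)) (3 / 5) fst (break a) (near_line a eta)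
      (affine_at (left_end (stages k)) c) (affine_at (right_end (stages k)) c)
      (left_time (stages k)) (right_time (stages k)).
  move=> eta0; elim: k => [|k IH].
    rewrite /affine_at /= !mul0r !addr0; apply: near_line_renorm => //.
    by have := cP 0%N; rewrite ca /affine_at /= mul0r addr0 => /andP[].
  have /andP[cl cr] := cP k.+1; rewrite /stages iterS /= in cl cr *.
  rewrite -/(stages k) in cl cr IH *.
  have rr : renorm (quad_map a (2 / 5)) (3 / 5) fst (break a) (near_line a eta)
      (affine_at (left_end (stages k)) c) (affine_at (next_right (stages k)) c)
      (right_time (stages k) + left_time (stages k)) (right_time (stages k)).
    have := renorm_induce_right lam01 IH; rewrite ca -next_rightE; exact.
  have := renorm_induce_left lam01 rr; rewrite ca -next_leftE; exact.
have gap k : affine_at (right_end (stages k)) c - affine_at (left_end (stages k)) c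
    <= (3 / 5) ^+ k * (24 / 25).
  elim: k => [|k IH]; first by rewrite /affine_at /= expr0; lra.
  rewrite {1 2}/stages iterS -/(stages k) /= next_leftE.
  have /andP[cl cr] := cP k.
  have m0 := renorm_m (renorm_stages k _ ltr01).
  have v1 : (3 / 5) ^+ (right_time (stages k) + left_time (stages k)) <= 3 / 5 :> R.
    rewrite -[leRHS]expr1; apply: ler_wiXn2l; [lra|lra|].
    by rewrite addn_gt0 m0 orbT.
  have v0 : 0 < (3 / 5) ^+ (right_time (stages k) + left_time (stages k)) :> R.
    by rewrite exprn_gt0//; lra.
  by rewrite exprS; nra.
split.
- move=> r s; rewrite prod_normE /= subrr normr0; apply/max_idPl.
  exact: normr_ge0.
- move=> eta w [_ [_ _ _ w1] we]; rewrite prod_normE /= subrr normr0.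
  by rewrite ge_max ler_norml; lra.
- by move=> eta eta'; exact: near_line_mono.
- by move=> eta eta0; exact: near_line_reached.
- move=> d d0; have [||k kd] := @geometric_lt R (3 / 5) d; [lra|lra|].
  exists (affine_at (left_end (stages k)) c), (affine_at (right_end (stages k)) c).
  exists (left_time (stages k)), (right_time (stages k)); split; last first.
    by move=> eta eta0; exact: renorm_stages.
  by apply: le_lt_trans (gap k) _; have : 0 < (3 / 5) ^+ k :> R; [rewrite exprn_gt0//; lra|lra].
Qed.

End CantorParameter.

Theorem theorem4 (R : realType) :
  (forall a b : R, 2 / 5 <= a <= 1 / 2 -> b = 2 / 5 ->
     forall x : R * R, quad_domain a b x ->
       asymptotic_to (quad_map a b) x (attractor a b)) /\
  (exists a b : R,
     [/\ 2 / 5 <= a <= 1 / 2, b = 2 / 5,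
         is_cantor_set R (attractor a b) &
         forall x : R * R, quad_domain a b x ->
           asymptotic_to (quad_map a b) x (attractor a b)]).
Proof.
have asymptotic (a b : R) : 2 / 5 <= a <= 1 / 2 -> b = 2 / 5 ->
    forall x : R * R, quad_domain a b x ->
      asymptotic_to (quad_map a b) x (attractor a b).
  by move=> a_range -> x dx; rewrite /asymptotic_to (attractorE a_range dx).
split=> //; have [a [a_range cantor]] := cantor_parameter R.
by exists a, (2 / 5); split=> //; exact: asymptotic.
Qed.
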